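(* Consider the pole-expansion algorithm for the local conductivity described in the context, with $k\ge1$ and parameters $\zeta=(\beta,\eta,\omega,E_F)$, in the limit $\beta\to\infty$, $\omega,\eta\to0$ with $|\omega|\lesssim\eta$ and $E_F\in(-1,1)$. Assume that solving a single linear system of the form $(H-zI)^{-1}v$ is less expensive than $\mathcal O(\eta^{-3/2})$ inner products. Then the dominant computational cost of the algorithm is $$\#\mathrm{IP}=\mathcal O\bigl(k\,\eta^{-3/2}\bigr)+\begin{cases}\mathcal O(\eta^{-3/2})&\text{if }\beta\eta^{1/2}\lesssim k,\\ \mathcal O\bigl(\tfrac{\beta\eta^{-1}}{k}\bigr)&\text{if }\beta\eta\lesssim k\lesssim\beta\eta^{1/2},\\ \mathcal O\bigl(\tfrac{\beta^2}{k^2}\bigr)&\text{if }k\lesssim\beta\eta\end{cases}$$ inner products. This cost (i.e. the sum of the two $\mathcal O$-bounds, up to constants) is minimized if we choose $$k=\begin{cases}\Theta(1)&\text{if }\beta\lesssim\eta^{-1/2},\\ \Theta(\beta^{1/2}\eta^{1/4})&\text{if }\eta^{-1/2}\lesssim\beta\lesssim\eta^{-3/2},\\ \Theta(\beta^{2/3}\eta^{1/2})&\text{if }\eta^{-3/2}\lesssim\beta,\end{cases}$$ which yields $$\#\mathrm{IP}=\begin{cases}\mathcal O(\eta^{-3/2})&\text{if }\beta\lesssim\eta^{-1/2},\\ \mathcal O(\beta^{1/2}\eta^{-5/4})&\text{if }\eta^{-1/2}\lesssim\beta\lesssim\eta^{-3/2},\\ \mathcal O(\beta^{2/3}\eta^{-1})&\text{if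 }\eta^{-3/2}\lesssim\beta.\end{cases}$$
   Context: **Task.** Given a Hermitian matrix $H$ with spectrum in $[-1,1]$, matrices $M_p,M_{p'}$ and a unit vector $e$, evaluate approximately $\sum_{i_1,i_2}G(\varepsilon_{i_1},\varepsilon_{i_2})\langle e|v_{i_1}\rangle\langle v_{i_1}|M_p|v_{i_2}\rangle\langle v_{i_2}|M_{p'}|e\rangle$ ($(\varepsilon_i,v_i)$ eigenpairs of $H$) for $G=F_\zeta$, where $f_\beta(E)=(1+e^{\beta E})^{-1}$ and $F_\zeta(E_1,E_2)=\frac{f_\beta(E_1-E_F)-f_\beta(E_2-E_F)}{(E_1-E_2)(E_1-E_2+\omega+i\eta)}$. **Basic algorithm.** For $G\approx\sum_{(k_1,k_2)\in K}c_{k_1k_2}\,q(E_1)T_{k_1}(E_1)\,q(E_2)T_{k_2}(E_2)$ with finite $K\subset\mathbb N^2$ ($T_k$ Chebyshev polynomials, $q$ a weight, $q=1$ by default): compute $v_{k_1}=M_pq(H)T_{k_1}(H)e$, $w_{k_2}=q(H)T_{k_2}(H)M_{p'}e$ for all occurring indices, by the three-term recurrence, and sum $c_{k_1k_2}\langle v_{k_1}|w_{k_2}\rangle$ over $(k_1,k_2)\in K$. This uses $|K|$ inner products, a number of matrix-vector products bounded by the number of distinct first indices plus the number of distinct second indices, and, if $q(E)=(E-z)^{-1}$, linear solves with $H-zI$. Matrix-vector products and inner products both cost a number of floating-point operations linear in the matrix size and are counted as equally expensive. **Pole-expansion algorithm.** One uses the decomposition $$F_\zeta=\tfrac{1}{E_1-E_2+\omega+i\eta}\Bigl(\sum_{z\in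 Z_k}\tfrac1\beta\tfrac{1}{(E_1-z)(E_2-z)}+R_k(E_1,E_2)\Bigr),\quad Z_k=\{E_F+\tfrac{\ell\pi i}{\beta}:\ell=-2k+1,-2k+3,\dots,2k-1\},$$ where $R_k$ is analytic on $E(\alpha_k)^2$ and $\alpha_k$ is the parameter of the Bernstein ellipse through $E_F\pm\frac{(2k+1)\pi i}{\beta}$. (i) The remainder term $\frac{R_k}{E_1-E_2+\omega+i\eta}$ is evaluated by the basic algorithm with its truncated Chebyshev series. (ii) For each $z\in Z_k$ the term $\frac1\beta\frac{1}{(E_1-z)(E_2-z)(E_1-E_2+\omega+i\eta)}$ is evaluated by the basic algorithm with weight $q(E)=(E-z)^{-1}$ and with the truncated Chebyshev series of $\frac{1}{E_1-E_2+\omega+i\eta}$. $\#\mathrm{IP}$ is the total number of inner products. **Truncation.** Each series is truncated to $K(\tau)=\{(k_1,k_2)\in\mathbb N^2:\exp(-\alpha_{\rm diag}(k_1+k_2)-\alpha_{\rm anti}|k_1-k_2|)\ge\tau\}$ for a fixed tolerance $\tau\in(0,1)$ (costs are counted up to factors logarithmic in $\beta,\eta$ that arise if $\tau$ is coupled to an error tolerance), where $\alpha_{\rm diag}=\frac12(\alpha_{\max}+\alpha_{\min})$, $\alpha_{\rm anti}=\frac12(\alpha_{\max}-\alpha_{\min})$ are the decay rates of the Chebyshev coefficients, given as follows. For a curve $b$ joining $\pm1$ let $\alpha_b(x)=\log|x+\sqrt[b]{x^2-1}|$ with the branch of the root having cut $b$ and $x+\sqrt[b]{x^2-1}\to\infty$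 as $x\to\infty$; $E(\alpha)=\{x:\alpha_{[-1,1]}(x)<\alpha\}$; the parameter of the ellipse through $x$ is $\alpha_{[-1,1]}(x)$. For the remainder term, $\alpha_{\max}=\min\{\alpha_{[-1,1]}(1-|\omega|+i\eta),\alpha_k\}$, and for the pole terms $\alpha_{\max}=\alpha_{[-1,1]}(1-|\omega|+i\eta)$. In both cases put $D=(E(\alpha_{\max})+\omega+i\eta)\cap\{\operatorname{Im}x\le0\}$, $b^\star=([-1,1]\setminus D)\cup\{x\in\partial D:\operatorname{Im}x<0\}$, $m=\min_{x\in\partial E(\alpha_{\max})+\omega+i\eta}\alpha_{b^\star}(x+0i)$ ($x+0i$: limit from above); then $\alpha_{\min}=\min\{m,\alpha_k\}$ for the remainder term and $\alpha_{\min}=m$ for the pole terms. **Notation.** $f=\mathcal O(g)$: $\limsup|f|/|g|<\infty$; $f=\Theta(g)$: $\limsup f/g<\infty$ and $\liminf f/g>0$; $\lesssim$: inequality up to a positive constant; all in the stated limit. *)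

(* Defs.v *)
From HB Require Import structures.
From mathcomp Require Import all_boot all_order all_algebra.
From mathcomp Require Import finmap complex.
From mathcomp Require Import all_classical all_reals all_analysis.

Set Implicit Arguments.
Unset Strict Implicit.
Unset Printing Implicit Defensive.

Import Order.TTheory GRing.Theory Num.Theory.
Import numFieldNormedType.Exports.
Import Normc.

Local Open Scope classical_set_scope.
Local Open Scope ring_scope.
Local Open Scope complex_scope.

(* [R[i]] itself carries no topology in the library; its regular module does,
   namely the usual one. *)
Notation Cplx R := (R[i]^o).

Section Potential.
Context {R : realType}.
Local Notation C := (Cplx R).
Implicit Types (b A : set C) (x w : C) (a : R).

(* The branch of the square root of x^2 - 1 with cut b for which
   x + sqrt(x^2 - 1) tends to infinity with x. The equation is imposed on b
   too, so that on b one of the two square roots is taken; in particular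
   |x + s x| = 1 on [-1, 1]. *)
Definition is_sqrt_branch b (s : C -> C) : Prop :=
  [/\ forall x, s x ^+ 2 = x ^+ 2 - 1,
      forall x, ~ b x -> {for x, continuous s}
    & forall M : R, exists r : R,
        forall x, r < normc x -> M < normc (x + s x)].

Definition sqrt_branch b : C -> C := get (is_sqrt_branch b).

Definition alpha b x : R := ln (normc (x + sqrt_branch b x)).

(* alpha_b (x + 0i) *)
Definition alpha_above b x : R :=
  lim (alpha b (x + (0 +i* t : C)) @[t --> (0 : R)^'+]).

Definition unit_segment : set C := [set x | Im x = 0 /\ -1 <= Re x <= 1].

Definition ellipse a : set C := [set x | alpha unit_segment x < a].

Definition frontier A : set C := closure A `\` interior A.

Definition lower_cap a w : set C :=
  [set x + w | x in ellipse a] `&` [set x | Im x <= 0].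

Definition bstar a w : set C :=
  (unit_segment `\` lower_cap a w)
  `|` [set x | frontier (lower_cap a w) x /\ Im x < 0].

(* The minimum over the (compact) shifted ellipse. It is negative as soon as
   the shifted ellipse dips below the real axis: between [-1, 1] and bstar the
   function alpha_bstar is the opposite of alpha_[-1,1]. *)
Definition min_alpha a w : R :=
  inf [set alpha_above (bstar a w) (x + w) | x in frontier (ellipse a)].

End Potential.

Section Costs.
Context {R : realType}.
Local Notation C := (Cplx R).
Implicit Types (tau beta eta omega EF : R) (k : nat).

Definition alpha_k beta EF k : R :=
  alpha unit_segment (EF +i* ((2 * k + 1)%:R * pi / beta) : C).

Definition alpha_max_pole eta omega : R :=
  alpha unit_segment ((1 - `|omega|) +i* eta : C).

Definition alpha_min_pole eta omega : R :=
  min_alpha (alpha_max_pole eta omega) (omega +i* eta : C).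

Definition alpha_max_rem beta eta omega EF k : R :=
  Num.min (alpha_max_pole eta omega) (alpha_k beta EF k).

Definition alpha_min_rem beta eta omega EF k : R :=
  Num.min (min_alpha (alpha_max_rem beta eta omega EF k) (omega +i* eta : C))
          (alpha_k beta EF k).

Definition alpha_diag (amax amin : R) : R := (amax + amin) / 2.
Definition alpha_anti (amax amin : R) : R := (amax - amin) / 2.

Definition truncation tau (amax amin : R) : set (nat * nat) :=
  [set p | tau <= expR (- alpha_diag amax amin * (p.1%:R + p.2%:R)
                        - alpha_anti amax amin * `|p.1%:R - p.2%:R|)].

Definition K_rem tau beta eta omega EF k : set (nat * nat) :=
  truncation tau (alpha_max_rem beta eta omega EF k)
                 (alpha_min_rem beta eta omega EF k).

Definition K_pole tau eta omega : set (nat * nat) :=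
  truncation tau (alpha_max_pole eta omega) (alpha_min_pole eta omega).

(* Z_k, listed by l = - 2 k + 1 + 2 j for 0 <= j < 2 k *)
Definition poles beta EF k : seq C :=
  [seq EF +i* (((2 * j + 1)%:R - (2 * k)%:R) * pi / beta) | j <- iota 0 (2 * k)].

(* Cardinality of a finite set; 0 if the set is infinite. *)
Definition card_set {T : choiceType} (A : set T) : nat := #|` fset_set A|%fset.

(* Basic algorithm with index set K *)
Definition inner_products (K : set (nat * nat)) : nat := card_set K.
Definition matvec_bound (K : set (nat * nat)) : nat :=
  (card_set [set p.1 | p in K] + card_set [set p.2 | p in K])%N.

(* Pole-expansion algorithm: one run of the basic algorithm for the remainder
   and one for each pole *)
Definition total_inner_products tau beta eta omega EF k : nat :=
  (inner_products (K_rem tau beta eta omega EF k)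
   + \sum_(z <- poles beta EF k) inner_products (K_pole tau eta omega))%N.

Definition total_matvec_bound tau beta eta omega EF k : nat :=
  (matvec_bound (K_rem tau beta eta omega EF k)
   + \sum_(z <- poles beta EF k) matvec_bound (K_pole tau eta omega))%N.

(* [solve z] is the cost of one linear solve with H - z I. Since q(H) commutes
   with T_k(H), the two three-term recurrences of a pole term are started from
   q(H) e and q(H) M_p' e, which takes two solves. *)
Definition total_solve_cost (solve : C -> R) beta EF k : R :=
  \sum_(z <- poles beta EF k) (2 * solve z).

(* The sum of the two O-bounds for the number of inner products as a function
   of k; the thresholds between the three regimes, which are only determined
   up to constants, are placed where consecutive bounds agree. *)
Definition remainder_bound beta eta k : R :=
  if beta * eta `^ (1 / 2) <= k%:R then eta `^ (- (3 / 2))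
  else if beta * eta <= k%:R then beta * eta^-1 / k%:R
  else beta ^+ 2 / k%:R ^+ 2.

Definition cost_bound beta eta k : R :=
  k%:R * eta `^ (- (3 / 2)) + remainder_bound beta eta k.

End Costs.

(* f <= g up to a positive constant in the limit F *)
Definition lesssim {R : realType} {I : Type} (F : set_system I) (f g : I -> R)
    : Prop :=
  exists2 c : R, 0 < c & \forall i \near F, f i <= c * g i.

(* Main.v *)
Require Import Defs.
From mathcomp Require Import all_boot all_order all_algebra.
From mathcomp Require Import finmap complex.
From mathcomp Require Import all_classical all_reals all_analysis.
From mathcomp Require Import ring lra.

Set Implicit Arguments.
Unset Strict Implicit.
Unset Printing Implicit Defensive.

Import Order.TTheory GRing.Theory Num.Theory.
Import numFieldNormedType.Exports.
Import Normc.

Local Open Scope classical_set_scope.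
Local Open Scope ring_scope.

(* On the Bernstein ellipse of parameter a through X + i Y, t = (sinh a)^2 is
   the nonnegative root of t (t + 1 - X^2 - Y^2) = Y^2, so alpha on [-1, 1] can
   be estimated through this quadratic equation; with |omega| <~ eta it gives
   alpha_max = Theta(eta^(1/2)) for the pole terms. Any branch s satisfies
   |x + s| |x - s| = 1, hence alpha_b = +-alpha on [-1, 1] for every cut b. On
   the shifted ellipse the sign is + above the real line, since a vertical ray
   avoids the cut, and - just above the lower arc, where the shift by
   omega + i eta has lowered alpha by Theta(eta). Thus alpha_diag is
   Theta(eta) while alpha_anti is Theta(eta^(1/2)), and K(tau), the set of
   (k1, k2) with alpha_max |k1 - k2| + (alpha_max + alpha_min) min(k1, k2)
   <= -log tau, has Theta(eta^(-3/2)) elements. For the remainder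
   sinh(alpha_k) >= k / beta yields
   O((eta^(-1/2) + beta/k) (eta^(-1) + beta/k)) elements, which is comparable
   to the three-regime bound, and the optimal k follows from elementary
   inequalities of AM-GM type. *)

(** * The topology of R[i] *)

(** [sqrt_branch] is a choice among the functions satisfying [is_sqrt_branch]: nothing is known of
    it before an explicit branch is exhibited, and then its value is identified only where a ray to
    infinity avoids the cut. The proof needs such rays in axis directions only. Elsewhere the value
    up to sign is enough: on the lower arc alpha_b >= - alpha is already the wanted lower bound, and
    the minus sign itself is used at a single point, the bottom of the ellipse, to bound alpha_diag
    from above. The delicate estimate is the lower bound on alpha_diag. Near the ends of the lower
    arc, at depth close to eta, the horizontal shift can raise the parameter by as much as the
    vertical shift lowers it, up to a constant; that alpha_max is at most the parameter of 1 -
    |omega| + i eta is what leaves a net gain. The lower bound on alpha_diag yields every upper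
    bound on the counts. The upper bound on alpha_diag yields the lower bound on the count for a
    pole, by which the linear solves are absorbed into the inner products. *)

Section ComplexTopology.
Context {R : realType}.
Local Open Scope complex_scope.
Local Notation C := (Cplx R).
Local Notation Re := complex.Re.
Local Notation Im := complex.Im.

Lemma normcE (x : R[i]) : normc x = Num.sqrt (Re x ^+ 2 + Im x ^+ 2).
Proof. by case: x. Qed.

Lemma normc_ge0 (x : R[i]) : 0 <= normc x.
Proof. by rewrite normcE sqrtr_ge0. Qed.

Lemma sqr_normc (x : R[i]) : normc x ^+ 2 = Re x ^+ 2 + Im x ^+ 2.
Proof. by rewrite normcE sqr_sqrtr // addr_ge0 ?sqr_ge0. Qed.

Lemma Re_le_normc (x : R[i]) : `|Re x| <= normc x.
Proof.
by rewrite -(ler_pXn2r (ltn0Sn 1)) ?nnegrE ?normc_ge0// sqr_normc real_normK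
  ?num_real// lerDl sqr_ge0.
Qed.

Lemma Im_le_normc (x : R[i]) : `|Im x| <= normc x.
Proof.
by rewrite -(ler_pXn2r (ltn0Sn 1)) ?nnegrE ?normc_ge0// sqr_normc real_normK
  ?num_real// lerDr sqr_ge0.
Qed.

Lemma normc_le_Re_Im (x : R[i]) : normc x <= `|Re x| + `|Im x|.
Proof.
rewrite -(ler_pXn2r (ltn0Sn 1)) ?nnegrE ?normc_ge0 ?addr_ge0// sqr_normc.
rewrite sqrrD !real_normK ?num_real// lerD2r lerDl.
by rewrite mulrn_wge0// mulr_ge0.
Qed.

(** Balls of [R[i]^o] have radii in [R[i]]; a positive element of [R[i]] is real, so these balls are
    the discs of [normc]. *)
Lemma nbhs_normcP (x : C) (A : set C) :
  nbhs x A <-> exists2 e : R, 0 < e & forall y : C, normc (y - x) < e -> A y.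
Proof.
have ballE (e : R) (y : C) : ball x (e%:C : R[i]) y <-> normc (y - x) < e.
  by rewrite /ball/= distrC (_ : `|y - x| = (normc (y - x))%:C) ?ltcR.
split.
  move=> /nbhs_ballP[e/= e0 eA].
  have eE : e = (Re e)%:C.
    by move: e0; case: (e) => er ei; rewrite ltcE/= => /andP[/eqP ->].
  exists (Re e) => [|y /ballE]; first by move: e0; rewrite eE ltcR.
  by rewrite -eE; exact: eA.
move=> [e e0 eA]; apply/nbhs_ballP; exists (e%:C) => /=; first by rewrite ltcR.
by move=> y /ballE; exact: eA.
Qed.

Lemma Re_continuous : continuous (@complex.Re R : C -> R).
Proof.
move=> x A /nbhs_ballP[e/= e0 eA]; apply/nbhs_normcP; exists e => // y yx.
apply: eA; rewrite /ball/= distrC; apply: le_lt_trans yx.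
by rewrite (_ : Re y - Re x = Re (y - x)) ?Re_le_normc//; case: (x) (y) => [? ?] [].
Qed.

Lemma Im_continuous : continuous (@complex.Im R : C -> R).
Proof.
move=> x A /nbhs_ballP[e/= e0 eA]; apply/nbhs_normcP; exists e => // y yx.
apply: eA; rewrite /ball/= distrC; apply: le_lt_trans yx.
by rewrite (_ : Im y - Im x = Im (y - x)) ?Im_le_normc//; case: (x) (y) => [? ?] [].
Qed.

Lemma cvg_complex {T : Type} {F : set_system T} {FF : Filter F}
    (f g : T -> R) (a b : R) :
  f @ F --> a -> g @ F --> b -> (fun t => (f t +i* g t : C)) @ F --> (a +i* b : C).
Proof.
move=> fa gb A /nbhs_normcP[e e0 eA].
have e20 : 0 < e / 2 by rewrite divr_gt0.
move/cvgrPdist_lt: fa => /(_ _ e20) fa; move/cvgrPdist_lt: gb => /(_ _ e20) gb.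
suff : \forall t \near F, A (f t +i* g t : C) by [].
near=> t; apply: eA; apply: le_lt_trans (normc_le_Re_Im _) _.
have fat : `|f t - a| < e / 2 by rewrite distrC; near: t; exact: fa.
have gbt : `|g t - b| < e / 2 by rewrite distrC; near: t; exact: gb.
by rewrite [e]splitr; exact: ltrD.
Unshelve. all: by end_near. Qed.

Lemma cvg_normc {T : Type} {F : set_system T} {FF : Filter F} (f : T -> C) (a : C) :
  f @ F --> a -> (fun t => normc (f t)) @ F --> normc a.
Proof.
move=> fa; rewrite normcE; under eq_fun do rewrite normcE.
have cRe : Re (f t) @[t --> F] --> Re a by apply: cvg_comp fa _; exact: Re_continuous.
have cIm : Im (f t) @[t --> F] --> Im a by apply: cvg_comp fa _; exact: Im_continuous.
apply: continuous_cvg; first exact: sqrt_continuous.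
by apply: cvgD; rewrite expr2; under eq_fun do rewrite expr2; apply: cvgM.
Qed.

Lemma addcE (x y : C) : x + y = ((Re x + Re y) +i* (Im x + Im y) : C).
Proof. by case: x y => [? ?] []. Qed.

Lemma cvg_cplxD {T : Type} {F : set_system T} {FF : Filter F} (f g : T -> C)
    (a b : C) :
  f @ F --> a -> g @ F --> b -> (fun t => f t + g t) @ F --> a + b.
Proof.
move=> fa gb; rewrite addcE; under eq_fun do rewrite addcE.
by apply: cvg_complex; apply: cvgD; apply: cvg_comp; try eassumption;
  [exact: Re_continuous|exact: Re_continuous|exact: Im_continuous|
   exact: Im_continuous].
Qed.

End ComplexTopology.

(** * Hyperbolic functions and confocal ellipses *)

Section Hyperbolic.
Context {R : realType}.
Implicit Types a b : R.

Definition cosh a : R := (expR a + expR (- a)) / 2.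
Definition sinh a : R := (expR a - expR (- a)) / 2.

Lemma cosh_norm a : cosh `|a| = cosh a.
Proof. by case: ger0P => // _; rewrite /cosh opprK addrC. Qed.

Lemma coshE a : cosh a ^+ 2 = 1 + sinh a ^+ 2.
Proof. by rewrite /cosh /sinh; have := expRxMexpNx_1 a; lra. Qed.

Lemma cosh_gt0 a : 0 < cosh a.
Proof. by rewrite /cosh divr_gt0// addr_gt0// expR_gt0. Qed.

Lemma subr_cosh a b :
  2 * (cosh a - cosh b) = (expR a - expR b) * (1 - expR (- a) * expR (- b)).
Proof.
rewrite /cosh; have := expRxMexpNx_1 a; have := expRxMexpNx_1 b.
move=> hb ha; have : expR a * (expR (- a) * expR (- b)) = expR (- b).
  by rewrite mulrA ha mul1r.
have : expR b * (expR (- a) * expR (- b)) = expR (- a).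
  by rewrite mulrCA hb mulr1.
lra.
Qed.

Lemma cosh_ltr a b : 0 <= a -> a < b -> cosh a < cosh b.
Proof.
move=> a0 ab; rewrite -subr_gt0 -(pmulr_rgt0 _ (ltr0n _ 2)) subr_cosh mulr_gt0//.
  by rewrite subr_gt0 ltr_expR.
rewrite subr_gt0 -expRD expR_lt1; lra.
Qed.

Lemma ler_cosh a b : 0 <= a -> 0 <= b -> (cosh a <= cosh b) = (a <= b).
Proof.
move=> a0 b0; have [ab|ba] := leP a b; last first.
  by apply/negbTE; rewrite -ltNge cosh_ltr.
by move: ab; rewrite le_eqVlt => /predU1P[->|/(cosh_ltr a0)/ltW//]; exact: lexx.
Qed.

Lemma ltr_cosh a b : 0 <= a -> 0 <= b -> (cosh a < cosh b) = (a < b).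
Proof. by move=> a0 b0; rewrite !ltNge ler_cosh. Qed.

Lemma half_le_sinh a : 0 <= a -> a / 2 <= sinh a.
Proof.
move=> a0; have := expR_ge1Dx a; have := expRxMexpNx_1 a.
rewrite /sinh; have := expR_gt0 (- a); nra.
Qed.

Lemma sinh_le a : 0 <= a <= 1 / 2 -> sinh a <= 2 * a.
Proof.
move=> a0; have := expR_ge1Dx (- a); have := expRxMexpNx_1 a.
rewrite /sinh; have := expR_gt0 a; nra.
Qed.

Lemma sinh_ge0 a : 0 <= a -> 0 <= sinh a.
Proof. by move=> a0; have := half_le_sinh a0; lra. Qed.

Lemma subr_le_sinh a b : 0 <= b <= a -> a - b <= 2 * (sinh a - sinh b).
Proof.
move=> /andP[b0 ba].
have e1 : expR (- a) <= expR (- b) by rewrite ler_expR lerN2.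
have e2 : a - b <= expR a - expR b.
  have -> : expR a = expR b * expR (a - b) by rewrite -expRD addrC subrK.
  have := expR_ge1Dx (a - b); have := expR_ge1Dx b; nra.
rewrite /sinh; lra.
Qed.

(** In the factorization [subr_cosh] the first factor is at most [4 * (a - b)], because
    [expR a <= 4], and the second is at most [a + b <= 2 * a]. *)
Lemma cosh_sub_le a b : 0 <= b <= a -> a <= 1 ->
  cosh a - cosh b <= 4 * a * (a - b).
Proof.
move=> /andP[b0 ba] a1.
have ea : expR a <= 4.
  have -> : a = a / 2 + a / 2 by rewrite -splitr.
  have := expR_ge1Dx (- (a / 2)); have := expRxMexpNx_1 (a / 2).
  rewrite expRD; have := expR_gt0 (a / 2); nra.
have e1 : expR a - expR b <= expR a * (a - b).
  have -> : expR b = expR a * expR (b - a) by rewrite -expRD addrC subrK.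
  have := expR_ge1Dx (b - a); have := expR_gt0 a; nra.
have e2 : 1 - expR (- a) * expR (- b) <= a + b.
  by rewrite -expRD; have := expR_ge1Dx (- a - b); lra.
have e3 : 0 <= expR a - expR b by rewrite subr_ge0 ler_expR.
have e4 : 0 <= 1 - expR (- a) * expR (- b).
  by rewrite -expRD subr_ge0 expR_le1; lra.
have : (expR a - expR b) * (1 - expR (- a) * expR (- b)) <=
    (4 * (a - b)) * (2 * a).
  apply: ler_pM => //; last lra.
  by apply: le_trans e1 _; rewrite ler_wpM2r// subr_ge0.
by rewrite -subr_cosh; lra.
Qed.

End Hyperbolic.

(** * Confocal ellipses through a quadratic equation *)

Section Confocal.
Context {R : realType}.
Local Open Scope complex_scope.
Local Notation C := (Cplx R).
Local Notation Re := complex.Re.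
Local Notation Im := complex.Im.
Implicit Types x y : C.

(** On the Bernstein ellipse of parameter a this is the major axis, [2 * cosh a]. *)
Definition focal_sum x : R := normc (x - 1) + normc (x + 1).

(* [sinh_sq x] is the square of [sinh a] when [x] lies on the boundary of
   the Bernstein ellipse of parameter [a]. *)
Definition sinh_sq x : R := (focal_sum x / 2) ^+ 2 - 1.

Lemma focal_sum_continuous : continuous focal_sum.
Proof.
move=> x; have h (c : C) : (fun y : C => normc (y + c)) @ x --> normc (x + c).
  have xC : (fun y : C => y) @ x --> x by [].
  exact: cvg_normc (cvg_cplxD xC (cvg_cst c)).
exact: cvgD (h (- 1)) (h 1).
Qed.

Lemma sinh_sqE x : 2 * sinh_sq x =
  Re x ^+ 2 + Im x ^+ 2 - 1 + normc (x - 1) * normc (x + 1).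
Proof.
rewrite /sinh_sq /focal_sum; have := sqr_normc (x - 1); have := sqr_normc (x + 1).
case: x => a b /=; lra.
Qed.

Lemma focal_sum_ge2 x : 2 <= focal_sum x.
Proof.
have := Re_le_normc (x - 1); have := Re_le_normc (x + 1).
rewrite /focal_sum; case: x => a b /=.
by move=> /ler_normlP[_ ?] /ler_normlP[? _]; lra.
Qed.

Lemma sinh_sq_ge0 x : 0 <= sinh_sq x.
Proof. by have := focal_sum_ge2 x; rewrite /sinh_sq; nra. Qed.

Lemma focal_sumE x : (focal_sum x / 2) ^+ 2 = sinh_sq x + 1.
Proof. by rewrite /sinh_sq subrK. Qed.

Lemma focal_sum_normc x : 2 * normc x <= focal_sum x.
Proof.
have -> : 2 * normc x = normc (x - 1 + (x + 1)).
  by rewrite addrACA addNr addr0 -mulr2n normcMn mulr_natl.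
exact: le_normcD.
Qed.

(** Isolating the product of the two focal distances in [sinh_sqE] and squaring removes all square
    roots. *)
Lemma sinh_sq_root x : let t := sinh_sq x in
  t * (t + 1 - Re x ^+ 2 - Im x ^+ 2) = Im x ^+ 2.
Proof.
have tE : normc (x - 1) * normc (x + 1) =
    2 * sinh_sq x - (Re x ^+ 2 + Im x ^+ 2 - 1) by have := sinh_sqE x; lra.
have := exprMn 2 (normc (x - 1)) (normc (x + 1)).
rewrite tE !sqr_normc; move: (sinh_sq x) => t; case: (x) => a b /=; lra.
Qed.

(** Among positive [t] the inequality holds exactly from the nonnegative root of the quadratic on,
    so an upper bound on [sinh_sq] is obtained by testing a candidate. The value [t = 0] would pass
    the test at every real [x]. *)
Lemma sinh_sq_le x (t : R) : 0 < t ->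
  Im x ^+ 2 <= t * (t + 1 - Re x ^+ 2 - Im x ^+ 2) -> sinh_sq x <= t.
Proof.
move=> t0 ht; have /= := sinh_sq_root x; have := sinh_sq_ge0 x.
have := sqr_ge0 (Im x); rewrite leNgt => i0 s0 hs; apply/negP => tx.
have : 0 <= sinh_sq x + 1 - Re x ^+ 2 - Im x ^+ 2 by nra.
nra.
Qed.

Lemma le_sinh_sq_Im x : Im x ^+ 2 <= sinh_sq x.
Proof.
have := sinh_sq_root x; have := sinh_sq_ge0 x; move: (sinh_sq x) => t t0 /=.
have := sqr_ge0 (Re x); have := sqr_ge0 (Im x); nra.
Qed.

End Confocal.

(** * Branches of the square root *)

Section Branches.
Context {R : realType}.
Local Open Scope complex_scope.
Local Notation C := (Cplx R).
Local Notation Re := complex.Re.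
Local Notation Im := complex.Im.
Implicit Types (x y : C) (b D : set C) (s : C -> C).

Lemma normc_sqrt_branchM (x s : C) : s ^+ 2 = x ^+ 2 - 1 ->
  normc (x + s) * normc (x - s) = 1.
Proof.
move=> sE; rewrite -normcM [X in normc X](_ : _ = 1) ?normc1//.
rewrite -[_ * _]/((x + s : R[i]) * (x - s)) mulrC -subr_sqr.
by rewrite -[s ^+ 2]/((s : C) ^+ 2) sE subKr.
Qed.

(** Compare squares by the parallelogram law. The pairs [(x, s)] and [(x, 1)] exchange roles: the
    cross term is 1 on the left and [|x - 1| |x + 1| = |s| ^ 2] on the right. *)
Lemma normc_sqrt_branchD (x s : C) : s ^+ 2 = x ^+ 2 - 1 ->
  normc (x + s) + normc (x - s) = focal_sum x.
Proof.
move=> sE.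
have ns : normc s ^+ 2 = normc (x - 1) * normc (x + 1).
  rewrite expr2 -!normcM -expr2; congr normc.
  by rewrite -[s ^+ 2]/((s : C) ^+ 2) sE -(expr1n _ 2) subr_sqr expr1n.
apply/eqP; rewrite -(eqrXn2 (ltn0Sn 1)) ?addr_ge0 ?normc_ge0//; apply/eqP.
have := normc_sqrt_branchM sE; rewrite /focal_sum !sqrrD -ns !sqr_normc => ->.
by case: (x) (s) => [a c] [d e] /=; lra.
Qed.

(** The moduli of [x + s] and [x - s] are reciprocal, so half their sum is the hyperbolic cosine of
    the logarithm of either. The choice of root affects only the sign of the logarithm. *)
Lemma cosh_ln_normc (x s : C) : s ^+ 2 = x ^+ 2 - 1 ->
  cosh (ln (normc (x + s))) = focal_sum x / 2.
Proof.
move=> sE; have := normc_sqrt_branchD sE; have := normc_sqrt_branchM sE.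
have := normc_ge0 (x + s); move: (normc (x + s)) (normc (x - s)) => u v u0 uv <-.
have {}u0 : 0 < u.
  rewrite lt_neqAle u0 andbT; apply/eqP => u_; move: uv.
  by rewrite -u_ mul0r => /eqP; rewrite eq_sym oner_eq0.
rewrite /cosh expRN lnK ?posrE//; congr ((_ + _) / _).
by rewrite -[RHS](mulKf (lt0r_neq0 u0)) uv mulr1.
Qed.

Lemma sqrt_branchP b s : is_sqrt_branch b s -> is_sqrt_branch b (sqrt_branch b).
Proof. by move=> bs; apply: getPex; exists s. Qed.

Lemma cosh_alpha b s x : is_sqrt_branch b s ->
  cosh (alpha b x) = focal_sum x / 2.
Proof. by move=> /sqrt_branchP[sE _ _]; exact: cosh_ln_normc. Qed.

Definition ray x (d : C) (t : R) : C :=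
  (Re x + t * Re d) +i* (Im x + t * Im d).

(** Two branches agree up to sign. Far out on the ray they are equal, since opposite values would
    make both [|y + s'|] and [|y - s'|] exceed 1 while their product is 1. The sign cannot change
    along the ray, because the root vanishes only at 1 and -1, which lie on the cut. *)
Lemma sqrt_branch_unique b s s' x (d : C) :
  is_sqrt_branch b s -> is_sqrt_branch b s' -> normc d = 1 ->
  b 1 -> b (- 1) -> (forall t, 0 <= t -> ~ b (ray x d t)) -> s x = s' x.
Proof.
move=> [sE sC sy] [s'E s'C s'y] d1 b1 bN1 nb.
have ss' y : s y = s' y \/ s y = - s' y.
  have : ((s y : R[i]) == s' y) || ((s y : R[i]) == - s' y).
    by rewrite -eqf_sqr; apply/eqP; rewrite -[LHS]/((s y : C) ^+ 2) sE -s'E.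
  by move=> /orP[]/eqP; [left|right].
have ray0 : ray x d 0 = x by rewrite /ray !mul0r !addr0; case: (x).
have s'0 t : 0 <= t -> s' (ray x d t) != 0.
  move=> t0; apply/eqP => s0; have := s'E (ray x d t).
  rewrite s0 expr0n/= => /eqP; rewrite eq_sym subr_eq0 -[X in _ == X](expr1n _ 2).
  rewrite eqf_sqr => /orP[]/eqP rE; have := nb _ t0; rewrite rE //.
have [M1 hM1] := sy 1; have [M2 hM2] := s'y 1.
(* The point of the ray at parameter [M] has modulus at least [M - normc x], hence lies beyond the
   radii [M1] and [M2] past which both branches satisfy [1 < |y + s y|]. *)
pose M := `|M1| + `|M2| + normc x + 1.
have M0 : 0 <= M by rewrite /M !addr_ge0 ?normc_ge0.
have MM : `|M1| + `|M2| < normc (ray x d M).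
  have : normc (ray x d M) + normc x >= M.
    rewrite -(normcN x); apply: le_trans (le_normcD _ _).
    rewrite [X in normc X](_ : _ = M%:C * d); last first.
      rewrite /ray; case: (x) (d) => [? ?] [? ?]; simpc.
      by congr (_ +i* _) => /=; rewrite ?mul0r ?subr0 ?addr0; ring.
    by rewrite normcM d1 mulr1/= expr0n addr0 sqrtr_sqr ger0_norm.
  by rewrite /M; lra.
(* The real inner product of the two branches does not vanish along the ray,
   and it is positive far away. *)
pose ip (y : C) := Re (s y) * Re (s' y) + Im (s y) * Im (s' y).
have ipE y (e : R) : s y = (e%:C * s' y)%R -> ip y = e * normc (s' y) ^+ 2.
  rewrite sqr_normc /ip => ->; case: (s' y) => ? ? /=; ring.
have sM : s (ray x d M) = s' (ray x d M).
  have [//|sN] := ss' (ray x d M).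
  have h1 : 1 < normc (ray x d M + s (ray x d M)).
    by apply: hM1; have := ler_norm M1; have := normr_ge0 M2; lra.
  have h2 : 1 < normc (ray x d M + s' (ray x d M)).
    by apply: hM2; have := ler_norm M2; have := normr_ge0 M1; lra.
  have uv := normc_sqrt_branchM (s'E (ray x d M)); rewrite sN in h1.
  by have := mulr_egt1 h2 h1; rewrite uv ltxx.
have [//|sN] := ss' x; exfalso.
have ip0 : ip x < 0.
  rewrite (ipE _ (- 1)); last by rewrite sN rmorphN1 mulN1r.
  rewrite mulN1r oppr_lt0 exprn_gt0// lt_neqAle normc_ge0 andbT eq_sym.
  by apply/eqP => /eq0_normc/eqP; rewrite -ray0 (negbTE (s'0 _ _)).
have ipM : 0 < ip (ray x d M).
  rewrite (ipE _ 1); last by rewrite sM rmorph1 mul1r.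
  rewrite mul1r exprn_gt0// lt_neqAle normc_ge0 andbT eq_sym.
  by apply/eqP => /eq0_normc/eqP; rewrite (negbTE (s'0 _ M0)).
have ipC : {within `[0, M], continuous (ip \o ray x d)}.
  apply: continuous_in_subspaceT => t /=.
  rewrite inE/= in_itv/= => /andP[t0 _].
  have rC : ray x d @ t --> ray x d t.
    apply: cvg_complex; apply: cvgD; (exact: cvg_cst || apply: cvgMl; exact: cvg_id).
  have c1 : (s \o ray x d) @ t --> s (ray x d t).
    by apply: cvg_comp rC _; exact: sC (nb _ t0).
  have c2 : (s' \o ray x d) @ t --> s' (ray x d t).
    by apply: cvg_comp rC _; exact: s'C (nb _ t0).
  apply: cvgD; apply: cvgM; apply: cvg_comp; try eassumption;
    by [exact: Re_continuous|exact: Im_continuous].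
have [|t] := @IVT R (ip \o ray x d) 0 M 0 M0 ipC.
  by rewrite /= ray0 minElt maxElt (lt_trans ip0 ipM); lra.
rewrite in_itv/= => /andP[t0 _].
have s'gt0 : 0 < normc (s' (ray x d t)) ^+ 2.
  rewrite exprn_gt0// lt_neqAle normc_ge0 andbT eq_sym.
  by apply/eqP => /eq0_normc/eqP; rewrite (negbTE (s'0 _ t0)).
have [sp|sp] := ss' (ray x d t).
- by rewrite (ipE _ 1) ?sp ?rmorph1 ?mul1r//; lra.
- by rewrite (ipE _ (- 1)) ?sp ?rmorphN1 ?mulN1r//; lra.
Qed.

End Branches.

(** * An explicit square root of x^2 - 1 *)

Section ExplicitBranch.
Context {R : realType}.
Local Open Scope complex_scope.
Local Notation C := (Cplx R).
Local Notation Re := complex.Re.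
Local Notation Im := complex.Im.
Implicit Types (x y : C) (b D : set C) (s : C -> C).

(* For x = cosh (a + i th): sinh a * |cos th| and cosh a * |sin th| *)
Definition root_re x : R := Num.sqrt (sinh_sq x - Im x ^+ 2).
Definition root_im x : R := Num.sqrt (sinh_sq x + 1 - Re x ^+ 2).

Lemma root_im_arg_ge0 x : 0 <= sinh_sq x + 1 - Re x ^+ 2.
Proof.
have := sinh_sq_root x; have := sinh_sq_ge0 x; have := sinh_sqE x => /=.
have : 0 <= normc (x - 1) * normc (x + 1) by rewrite mulr_ge0 ?normc_ge0.
have := le_sinh_sq_Im x; have := sqr_ge0 (Re x); have := sqr_ge0 (Im x).
move: (_ * normc _) (sinh_sq x) => q t; nra.
Qed.

Lemma sqr_root_re x : root_re x ^+ 2 = sinh_sq x - Im x ^+ 2.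
Proof. by rewrite sqr_sqrtr// subr_ge0 le_sinh_sq_Im. Qed.

Lemma sqr_root_im x : root_im x ^+ 2 = sinh_sq x + 1 - Re x ^+ 2.
Proof. by rewrite sqr_sqrtr// root_im_arg_ge0. Qed.

(** Expanding [(t - v^2) (t + 1 - u^2) = u^2 v^2], with x = u + i v and t = [sinh_sq x], gives
    exactly the quadratic equation for t. *)
Lemma root_reM_im x : root_re x * root_im x = `|Re x * Im x|.
Proof.
apply/eqP; rewrite -(eqrXn2 (ltn0Sn 1)) ?mulr_ge0 ?sqrtr_ge0//.
rewrite real_normK ?num_real// !exprMn sqr_root_re sqr_root_im.
by have := sinh_sq_root x => /=; move=> h; apply/eqP; lra.
Qed.

(** The value at 0 is 1, not 0: squares of signs must be 1 on the axes as well. *)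
Definition sgn (u : R) : R := if u < 0 then - 1 else 1.

Lemma sgn_norm u : sgn u * `|u| = u.
Proof.
by rewrite /sgn; case: ltrP => [/ltr0_norm|/ger0_norm] ->; rewrite ?mulrNN mul1r.
Qed.

Lemma sgn_sqr u : sgn u * sgn u = 1.
Proof. by rewrite /sgn; case: ifP; rewrite ?mulrNN mul1r. Qed.

Lemma normr_sgn u : `|sgn u| = 1.
Proof. by rewrite /sgn; case: ifP; rewrite ?normrN normr1. Qed.

(** The root lying in the closed quadrant of [x], for which [|x + s|] is the larger of the moduli of
    [x + s] and [x - s], hence at least 1. *)
Definition quadrant_root x : C :=
  (sgn (Re x) * root_re x) +i* (sgn (Im x) * root_im x).

(* When D is the part of the lower cap below the real axis, this is the branch
   of sqrt (x ^ 2 - 1) with cut [bstar]. *)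
Definition flip D x : R := if `[< D x >] then - 1 else 1.
Definition flipped_root D x : C := (flip D x)%:C * quadrant_root x.

Lemma flip_sqr D x : flip D x * flip D x = 1.
Proof. by rewrite /flip; case: ifP; rewrite ?mulrNN mul1r. Qed.

Lemma normr_flip D x : `|flip D x| = 1.
Proof. by rewrite /flip; case: ifP; rewrite ?normrN normr1. Qed.

Lemma flipped_rootE D x : flipped_root D x =
  (flip D x * sgn (Re x) * root_re x) +i* (flip D x * sgn (Im x) * root_im x).
Proof.
rewrite /flipped_root /quadrant_root -[_ * _]/((_ : R[i]) * (_ : R[i])); simpc.
by rewrite !mulrA.
Qed.

Lemma quadrant_root_sqr x : quadrant_root x ^+ 2 = x ^+ 2 - 1.
Proof.
have h1 : sgn (Re x) * root_re x * (sgn (Im x) * root_im x) = Re x * Im x.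
  by rewrite mulrACA root_reM_im normrM mulrACA !sgn_norm.
have h2 u v : (sgn u * v) * (sgn u * v) = v ^+ 2 :> R.
  by rewrite mulrACA sgn_sqr mul1r.
rewrite !expr2 /quadrant_root -[LHS]/((_ : R[i]) * (_ : R[i])).
rewrite -[x * x]/((x : R[i]) * (x : R[i])).
have := sqr_root_re x; have := sqr_root_im x; move: h1.
case: (x) => u v /= h1 h3 h4; simpc; rewrite !h2 [X in _ +i* (_ + X)]mulrC h1 h3 h4.
by congr (_ +i* _); ring.
Qed.

Lemma flipped_root_sqr D x : flipped_root D x ^+ 2 = x ^+ 2 - 1.
Proof.
rewrite -quadrant_root_sqr /flipped_root.
rewrite -[LHS]/(((flip D x)%:C * quadrant_root x : R[i]) ^+ 2).
by rewrite exprMn -rmorphXn/= expr2 flip_sqr rmorph1 mul1r.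
Qed.

Lemma quadrant_root_quadrant x :
  0 <= Re x * Re (quadrant_root x) /\ 0 <= Im x * Im (quadrant_root x).
Proof.
have h u t : 0 <= t -> 0 <= u * (sgn u * t).
  move=> t0; rewrite mulrA; apply: mulr_ge0 => //.
  by rewrite -{1}(sgn_norm u) mulrAC sgn_sqr mul1r.
by split; apply: h; exact: sqrtr_ge0.
Qed.

Lemma normc_quadrant_root x : normc x <= normc (x + quadrant_root x).
Proof.
rewrite -(ler_pXn2r (ltn0Sn 1)) ?nnegrE ?normc_ge0// !sqr_normc.
have := quadrant_root_quadrant x.
by case: (x) (quadrant_root x) => u v [u' v'] /= []; nra.
Qed.

Lemma normc_quadrant_root_ge1 x : 1 <= normc (x + quadrant_root x).
Proof.
have := normc_sqrt_branchM (quadrant_root_sqr x).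
have : normc (x - quadrant_root x) <= normc (x + quadrant_root x).
  rewrite -(ler_pXn2r (ltn0Sn 1)) ?nnegrE ?normc_ge0// !sqr_normc.
  have := quadrant_root_quadrant x.
  by case: (x) (quadrant_root x) => u v [u' v'] /= []; nra.
by have := normc_ge0 (x - quadrant_root x); nra.
Qed.

Lemma sinh_sq_continuous : continuous (@sinh_sq R).
Proof.
move=> x.
have h : (fun y : C => focal_sum y / 2) @ x --> focal_sum x / 2.
  exact: (cvgM (@focal_sum_continuous R x) (cvg_cst _)).
rewrite /continuous_at /sinh_sq expr2; under eq_fun do rewrite expr2.
exact: (cvgB (cvgM h h) (cvg_cst (1 : R))).
Qed.

Lemma root_re_continuous : continuous root_re.
Proof.
move=> x; have h := @Im_continuous R x.
have c := cvgB (@sinh_sq_continuous x) (cvgM h h).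
rewrite /continuous_at /root_re expr2; under eq_fun do rewrite expr2.
exact: continuous_cvg _ (@sqrt_continuous R _) (c _ _).
Qed.

Lemma root_im_continuous : continuous root_im.
Proof.
move=> x; have h := @Re_continuous R x.
have c := cvgB (cvgD (@sinh_sq_continuous x) (cvg_cst (1 : R))) (cvgM h h).
rewrite /continuous_at /root_im expr2; under eq_fun do rewrite expr2.
exact: continuous_cvg _ (@sqrt_continuous R _) (c _ _ _ _).
Qed.

(** A jump of the sign is harmless where the factor vanishes; this is how the coordinates of the
    explicit root stay continuous across the axes. *)
Lemma cvg_sign_mul (e f : C -> R) x :
  (forall y, `|e y| <= 1) -> {for x, continuous f} ->
  f x = 0 \/ (\forall y \near x, e y = e x) ->
  (fun y => e y * f y) @ x --> e x * f x.
Proof.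
have FF : Filter (nbhs x) := nbhs_filter x.
move=> e1 fx [fx0|ex].
  rewrite fx0 mulr0; apply/cvgr0Pnorm_lt => eps eps0.
  move: fx; rewrite /prop_for /continuous_at fx0 => /cvgr0Pnorm_lt/(_ _ eps0).
  apply: filterS => y; apply: le_lt_trans; rewrite normrM.
  by rewrite ler_piMl.
apply: cvg_trans (cvgM (cvg_cst (e x : R)) fx); apply: near_eq_cvg.
by near=> y; congr (_ * _); apply/esym; near: y.
Unshelve. all: by end_near. Qed.

Lemma root_re_eq0 x : Re x = 0 -> root_re x = 0.
Proof.
move=> x0; have := root_reM_im x; rewrite x0 mul0r normr0 => /eqP.
rewrite mulf_eq0 => /orP[/eqP//|/eqP b0]; have := sqr_root_im x.
by rewrite b0 x0 !expr0n/= subr0; have := sinh_sq_ge0 x; lra.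
Qed.

Lemma near_sgn (f : C -> R) x : {for x, continuous f} -> f x != 0 ->
  \forall y \near x, sgn (f y) = sgn (f x).
Proof.
have FF : Filter (nbhs x) := nbhs_filter x.
move=> fx; rewrite /sgn; case: ltrgtP => // f0 _.
  have h : \forall y \near x, f y < 0 by exact: cvgr_lt fx _ f0.
  by near=> y; rewrite ifT//; near: y.
have h : \forall y \near x, 0 < f y by exact: cvgr_gt fx _ f0.
by near=> y; rewrite ifF//; apply/negbTE; rewrite -leNgt ltW//; near: y.
Unshelve. all: by end_near. Qed.

End ExplicitBranch.

(** * Moving the cut by a change of sign *)

Section BstarBranch.
Context {R : realType}.
Local Open Scope complex_scope.
Local Notation C := (Cplx R).
Local Notation Re := complex.Re.
Local Notation Im := complex.Im.
Implicit Types (x y w : C) (b D : set C) (a : R).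

Lemma flip_near D x : (\forall y \near x, D y <-> D x) ->
  \forall y \near x, flip D y = flip D x.
Proof.
have FF : Filter (nbhs x) := nbhs_filter x.
by apply: filterS => y yx; rewrite /flip (propext yx).
Qed.

Lemma flip_true D x : D x -> flip D x = - 1.
Proof. by move=> Dx; rewrite /flip asboolT. Qed.

Lemma flip_false D x : ~ D x -> flip D x = 1.
Proof. by move=> Dx; rewrite /flip asboolF. Qed.

Lemma unit_segmentE x : unit_segment x <-> Im x = 0 /\ -1 <= Re x <= 1.
Proof.
rewrite /unit_segment/= -complexRe -complexIm !lecE/= oppr0 eqxx/=.
by split=> [[/complexI -> ->]|[-> ->]].
Qed.

Lemma sinh_sq_real x : Im x = 0 -> -1 <= Re x <= 1 -> sinh_sq x = 0.
Proof.
move=> x0 /andP[x1 x2]; rewrite /sinh_sq /focal_sum !normcE.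
case: x x0 x1 x2 => u v /= -> u1 u2; rewrite addr0 subr0 expr0n/= !addr0.
rewrite !sqrtr_sqr ler0_norm ?subr_le0// ger0_norm; lra.
Qed.

(** The quadrant root jumps only across [-1, 1], where its imaginary part changes sign. A change of
    sign on [D] cancels the jump wherever [D] touches the segment from below and creates a new one
    along the rest of the boundary of [D], which has to lie on the cut. Boundedness of [D] preserves
    the behaviour at infinity. *)
Lemma flipped_root_branch b D :
  (forall x, D x -> Im x < 0) ->
  (exists r, forall x, D x -> normc x <= r) ->
  (forall x, ~ b x -> Im x < 0 -> \forall y \near x, D y <-> D x) ->
  (forall x, ~ b x -> Im x = 0 ->
    1 < `|Re x| /\ (\forall y \near x, ~ D y) \/
    `|Re x| <= 1 /\ (\forall y \near x, Im y < 0 -> D y)) ->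
  is_sqrt_branch b (flipped_root D).
Proof.
move=> Dlow [r Dr] Hlow Hreal; split; first exact: flipped_root_sqr.
- move=> x bx.
  have FF : Filter (nbhs x) := nbhs_filter x.
  have cRe : {for x, continuous (@complex.Re R : C -> R)} := @Re_continuous R x.
  have cIm : {for x, continuous (@complex.Im R : C -> R)} := @Im_continuous R x.
  pose e1 y := flip D y * sgn (Re y); pose e2 y := flip D y * sgn (Im y).
  have e1_le y : `|e1 y| <= 1 by rewrite normrM normr_flip normr_sgn mulr1.
  have e2_le y : `|e2 y| <= 1 by rewrite normrM normr_flip normr_sgn mulr1.
  (* Each coordinate is a sign times a continuous function, so [cvg_sign_mul] applies to both. *)
  suff [h1 h2] : (root_re x = 0 \/ \forall y \near x, e1 y = e1 x) /\
               (root_im x = 0 \/ \forall y \near x, e2 y = e2 x).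
    have c1 := cvg_sign_mul e1_le (@root_re_continuous R x) h1.
    have c2 := cvg_sign_mul e2_le (@root_im_continuous R x) h2.
    have := @cvg_complex R _ _ FF _ _ _ _ c1 c2.
    rewrite /prop_for /continuous_at flipped_rootE.
    by under [X in X @ _ --> _ -> _]eq_fun do rewrite -flipped_rootE.
  have e1P : (\forall y \near x, flip D y = flip D x) ->
      root_re x = 0 \/ \forall y \near x, e1 y = e1 x.
    move=> fD; have [/root_re_eq0|x0] := eqVneq (Re x) 0; first by left.
    right; have sx := near_sgn cRe x0.
    near=> y; rewrite /e1; congr (_ * _); near: y; [exact: fD|exact: sx].
  have [x0|x0|x0] := ltgtP (Im x) 0.
  + have fD := flip_near (Hlow _ bx x0); split; first exact: e1P.
    right; have sx := near_sgn cIm (ltr0_neq0 x0).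
    near=> y; rewrite /e2; congr (_ * _); near: y; [exact: fD|exact: sx].
  + have fD : \forall y \near x, flip D y = flip D x.
      have h : \forall y \near x, 0 < Im y by exact: cvgr_gt cIm _ x0.
      have Dx : ~ D x by move=> /Dlow; rewrite ltNge ltW.
      near=> y; rewrite !flip_false//; move/Dlow; apply/negP; rewrite -leNgt.
      by apply/ltW; near: y.
    split; first exact: e1P.
    right; have sx := near_sgn cIm (lt0r_neq0 x0).
    near=> y; rewrite /e2; congr (_ * _); near: y; [exact: fD|exact: sx].
  (* On the real axis one coordinate vanishes: [root_im] outside [-1, 1], where nothing nearby is
     flipped, and [root_re] on [-1, 1], where just below the axis the flip and [sgn (Im y)] are both
     -1 and cancel. *)
  + have := sinh_sq_root x => /=; rewrite x0 expr0n/= subr0 => h.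
    have [[x1 nD]|[x1 nD]] := Hreal _ bx x0.
      split; [apply: e1P|left].
        have Dx : ~ D x by exact: nbhs_singleton nD.
        by near=> y; rewrite !flip_false//; near: y.
      apply/eqP; rewrite -sqrf_eq0 sqr_root_im.
      have {}x1 : 1 < Re x ^+ 2 by rewrite -(real_normK (num_real _)); nra.
      have tp : sinh_sq x != 0.
        apply/eqP => t0; have := root_im_arg_ge0 x; rewrite t0; lra.
      by move/eqP: h; rewrite mulf_eq0 (negbTE tp).
    split; [left|right].
      apply/eqP; rewrite -sqrf_eq0 sqr_root_re x0 sinh_sq_real ?expr0n ?subrr//.
      by rewrite -ler_norml.
    near=> y; rewrite /e2 x0 {2}/sgn ltxx mulr1 [flip D x]flip_false; last first.
      by move=> /Dlow; rewrite x0 ltxx.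
    rewrite /sgn; case: ltrP => y0.
      by rewrite flip_true ?mulrNN ?mulr1//; move: y0; near: y.
    by rewrite flip_false ?mulr1// => /Dlow; rewrite ltNge y0.
- move=> M; exists (Num.max r M) => x; rewrite gt_max => /andP[xr xM].
  apply: lt_le_trans xM _; rewrite /flipped_root flip_false ?rmorph1 ?mul1r.
    exact: normc_quadrant_root.
  by move=> /Dr; rewrite leNgt xr.
Unshelve. all: by end_near. Qed.

Lemma unit_segment_branch :
  is_sqrt_branch (@unit_segment R) (flipped_root set0).
Proof.
apply: flipped_root_branch => //; first by exists 0.
  by move=> x _ _; have FF := nbhs_filter x; near=> y.
move=> x xb x0; left; split; last first.
  by have FF := nbhs_filter x; near=> y.
by rewrite ltNge ler_norml; apply/negP => h; apply/xb/unit_segmentE.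
Unshelve. all: by end_near. Qed.

Lemma unit_segment1 : unit_segment (1 : C).
Proof. by apply/unit_segmentE; split => //=; lra. Qed.

Lemma unit_segmentN1 : unit_segment (- 1 : C).
Proof. by apply/unit_segmentE; split => /=; [rewrite oppr0|lra]. Qed.

Lemma normc_realC (e : R) : normc (e%:C) = `|e|.
Proof. by rewrite /= expr0n addr0 sqrtr_sqr. Qed.

Lemma normc_imC (e : R) : normc (0 +i* e) = `|e|.
Proof. by rewrite /= expr0n add0r sqrtr_sqr. Qed.

(** On the segment the focal sum is 2, so [cosh] of alpha is 1 and alpha is 0. Off the segment one
    of the four axis directions gives a ray that misses it, and the chosen branch agrees with the
    quadrant root. *)
Lemma alpha_segment_ge0 x : 0 <= alpha unit_segment x.
Proof.
have sb := sqrt_branchP unit_segment_branch.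
suff : unit_segment x \/ sqrt_branch unit_segment x = flipped_root set0 x.
  move=> [/unit_segmentE[x0 x1]|sE].
    have := cosh_alpha x unit_segment_branch.
    have -> : focal_sum x / 2 = 1.
      have := focal_sumE x; rewrite sinh_sq_real//; have := focal_sum_ge2 x; nra.
    rewrite -cosh_norm => c1; have : `|alpha unit_segment x| <= 0.
      by rewrite -ler_cosh// c1 /cosh oppr0 expR0; lra.
    by rewrite normr_le0 => /eqP ->.
  rewrite /alpha sE /flipped_root flip_false// rmorph1 mul1r.
  exact: ln_ge0 (normc_quadrant_root_ge1 x).
have uniq (d : C) : normc d = 1 ->
    (forall t, 0 <= t -> ~ unit_segment (ray x d t)) ->
    sqrt_branch unit_segment x = flipped_root set0 x.
  move=> d1; apply: sqrt_branch_unique sb unit_segment_branch d1 _ _.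
  - exact: unit_segment1.
  - exact: unit_segmentN1.
have [x0|x0|x0] := ltgtP (Im x) 0.
- right; apply: (uniq (0 +i* - 1)); first by rewrite normc_imC normrN1.
  by move=> t t0 /unit_segmentE[/= + _]; nra.
- right; apply: (uniq (0 +i* 1)); first by rewrite normc_imC normr1.
  by move=> t t0 /unit_segmentE[/= + _]; nra.
have [xm1|xm1] := ltP (Re x) (- 1).
  right; apply: (uniq ((- 1)%:C)); first by rewrite normc_realC normrN1.
  by move=> t t0 /unit_segmentE[/= _]; rewrite mulrN1; lra.
have [x1|x1] := ltP 1 (Re x).
  right; apply: (uniq (1%:C)); first by rewrite normc_realC normr1.
  by move=> t t0 /unit_segmentE[/= _]; rewrite mulr1; lra.
by left; apply/unit_segmentE; rewrite xm1 x1.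
Qed.

Lemma cosh_alpha_segment x : cosh (alpha unit_segment x) = focal_sum x / 2.
Proof. exact: cosh_alpha unit_segment_branch. Qed.

Lemma sinh_alpha_segment x : sinh (alpha unit_segment x) ^+ 2 = sinh_sq x.
Proof.
by have := coshE (alpha unit_segment x); rewrite cosh_alpha_segment focal_sumE; lra.
Qed.

Lemma ltr_sqr_sinh (u v : R) : 0 <= u -> 0 <= v ->
  (sinh u ^+ 2 < sinh v ^+ 2) = (u < v).
Proof.
move=> u0 v0; rewrite -(ltr_cosh u0 v0).
rewrite -[RHS](ltr_pXn2r (ltn0Sn 1)) ?nnegrE ?ltW ?cosh_gt0//.
by rewrite !coshE ltrD2l.
Qed.

(** Removes the chosen branch from the ellipse: what remains is a sublevel set of a continuous
    function. *)
Lemma ellipseE a x : 0 <= a -> ellipse a x <-> sinh_sq x < sinh a ^+ 2.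
Proof.
move=> a0; rewrite /ellipse/= -sinh_alpha_segment ltr_sqr_sinh//.
exact: alpha_segment_ge0.
Qed.

End BstarBranch.

(** * The shifted ellipse and its cut *)

Section ShiftedEllipse.
Context {R : realType}.
Local Open Scope complex_scope.
Local Notation C := (Cplx R).
Local Notation Re := complex.Re.
Local Notation Im := complex.Im.
Implicit Types (x y w : C) (a : R).

Lemma ler_sqr_sinh (u v : R) : 0 <= u -> 0 <= v ->
  (sinh u ^+ 2 <= sinh v ^+ 2) = (u <= v).
Proof. by move=> u0 v0; rewrite !leNgt ltr_sqr_sinh. Qed.

Lemma lower_capE a w x : 0 <= a ->
  lower_cap a w x <-> sinh_sq (x - w) < sinh a ^+ 2 /\ Im x <= 0.
Proof.
move=> a0; rewrite /lower_cap /setI/= -complexIm lecE/= eqxx/=.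
split=> [[[y /(ellipseE _ a0) ya <-] x0]|[h x0]]; split=> //.
  by rewrite addrK.
by exists (x - w); [exact/(ellipseE _ a0)|rewrite subrK].
Qed.

Lemma sinh_sq_sub_continuous w : continuous (fun y : C => sinh_sq (y - w)).
Proof.
move=> x; have FF : Filter (nbhs x) := nbhs_filter x.
have xC : (fun y : C => y) @ x --> x by [].
apply: (cvg_comp _ _ (cvg_cplxD xC (cvg_cst (- w)))).
exact: sinh_sq_continuous.
Qed.

Lemma near_sinh_sq_lt w x (c : R) : sinh_sq (x - w) < c ->
  \forall y \near x, sinh_sq (y - w) < c.
Proof.
have FF : Filter (nbhs x) := nbhs_filter x.
by move=> h; exact: cvgr_lt (@sinh_sq_sub_continuous w x) _ h.
Qed.

Lemma near_sinh_sq_gt w x (c : R) : c < sinh_sq (x - w) ->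
  \forall y \near x, c < sinh_sq (y - w).
Proof.
have FF : Filter (nbhs x) := nbhs_filter x.
by move=> h; exact: cvgr_gt (@sinh_sq_sub_continuous w x) _ h.
Qed.

Lemma near_Im_lt0 x : Im x < 0 -> \forall y \near x, Im y < 0.
Proof.
have FF : Filter (nbhs x) := nbhs_filter x.
by move=> h; exact: cvgr_lt (@Im_continuous R x) _ h.
Qed.

Lemma frontier_ellipse a x : 0 <= a -> frontier (ellipse a) x ->
  sinh_sq x = sinh a ^+ 2.
Proof.
move=> a0 [xc xi]; have FF : Filter (nbhs x) := nbhs_filter x.
apply/eqP; rewrite eq_le; apply/andP; split; rewrite leNgt; apply/negP => h.
  have h' : sinh a ^+ 2 < sinh_sq (x - 0) by rewrite subr0.
  have [y [/(ellipseE _ a0) ya]] := xc _ (near_sinh_sq_gt h').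
  by rewrite /= subr0 => /lt_trans/(_ ya); rewrite ltxx.
apply: xi; have h' : sinh_sq (x - 0) < sinh a ^+ 2 by rewrite subr0.
have := near_sinh_sq_lt h'; apply: filterS => y; rewrite subr0 => hy.
exact/(ellipseE _ a0).
Qed.

Lemma bstar_not_upper a w x : 0 < Im x -> ~ bstar a w x.
Proof.
move=> x0 [[/unit_segmentE[h _] _]|[_]]; first by move: x0; rewrite h ltxx.
by rewrite -complexIm ltcE/= eqxx/= ltNge ltW.
Qed.

Lemma bstar_not_inside a w x : 0 <= a -> Im x <= 0 ->
  sinh_sq (x - w) < sinh a ^+ 2 -> ~ bstar a w x.
Proof.
move=> a0 x0 xa; have xD : lower_cap a w x by exact/(lower_capE _ _ a0).
have FF : Filter (nbhs x) := nbhs_filter x.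
move=> [[_ /(_ xD)//]|[[_ xi]]]; rewrite -complexIm ltcE/= eqxx/= => {}x0.
apply: xi; have h1 := near_sinh_sq_lt xa; have h2 := near_Im_lt0 x0.
rewrite /interior; near=> y; apply/lower_capE => //; split.
  by near: y.
by apply/ltW; near: y.
Unshelve. all: by end_near. Qed.

(** The hypothesis keeps the closed shifted ellipse away from the real axis outside [-1, 1]; being
    strict, it persists in a neighbourhood of each such point, so nothing is flipped there. Real
    points of [-1, 1] off the cut lie inside the shifted ellipse, and so do the points just below
    them. *)
Lemma bstar_branch a w : 0 <= a ->
  (forall x, Im x = 0 -> 1 < `|Re x| -> sinh a ^+ 2 < sinh_sq (x - w)) ->
  is_sqrt_branch (bstar a w)
    (flipped_root (fun x => lower_cap a w x /\ Im x < 0)).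
Proof.
move=> a0 Hout; apply: flipped_root_branch.
- by move=> x [].
(* Inside the ellipse the modulus is at most half the focal sum, hence less than [cosh a]. *)
- exists (cosh a + normc w) => x [/(lower_capE _ _ a0)[h _] _].
  rewrite -[x](subrK w); apply: le_trans (le_normcD _ _) _; rewrite lerD2r.
  have := focal_sum_normc (x - w); have := focal_sumE (x - w).
  have := coshE a; have := cosh_gt0 a; have := focal_sum_ge2 (x - w); nra.
- move=> x xb x0; have FF : Filter (nbhs x) := nbhs_filter x.
  have nI := near_Im_lt0 x0.
  have [xc|/existsNP[A /not_implyP[xA]]] :=
      pselect (closure (lower_cap a w) x); last first.
    move=> /set0P/negP; rewrite negbK => /eqP DA.
    have nD y : A y -> ~ lower_cap a w y.
      by move=> Ay Dy; have : (lower_cap a w `&` A) y by []; rewrite DA.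
    near=> y; split=> [[/nD []]|[/nD []]]; [near: y; exact: xA|].
    exact: nbhs_singleton xA.
  have xi : nbhs x (lower_cap a w).
    apply: contrapT => xi; apply: xb; right; split=> //.
    by rewrite -complexIm ltcE/= eqxx.
  near=> y; split=> _; split=> //; last by near: y.
    exact: nbhs_singleton xi.
  by near: y.
- move=> x xb x0; have FF : Filter (nbhs x) := nbhs_filter x.
  have [x1|x1] := ltP 1 `|Re x|; [left|right]; split=> //.
    have h := near_sinh_sq_gt (Hout _ x0 x1).
    near=> y => -[/(lower_capE _ _ a0)[+ _] _]; apply/negP; rewrite -leNgt.
    by apply/ltW; near: y.
  have xD : lower_cap a w x.
    apply: contrapT => xD; apply: xb; left; split=> //; apply/unit_segmentE.
    by split=> //; rewrite -ler_norml.
  move: xD => /(lower_capE _ _ a0)[h _]; have {}h := near_sinh_sq_lt h.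
  near=> y => y0; split=> //; apply/lower_capE => //; split; last exact: ltW.
  by near: y.
Unshelve. all: by end_near. Qed.

(** If 1 or -1 were in the open shifted ellipse, so would be real points slightly beyond it, against
    the hypothesis. [sqrt_branch_unique] requires both endpoints on the cut. *)
Lemma bstar_endpoints a w : 0 <= a ->
  (forall x, Im x = 0 -> 1 < `|Re x| -> sinh a ^+ 2 < sinh_sq (x - w)) ->
  bstar a w 1 /\ bstar a w (- 1).
Proof.
move=> a0 Hout; have FF (x : C) : Filter (nbhs x) := nbhs_filter x.
have end_notin (e : R) : `|e| = 1 -> sinh a ^+ 2 <= sinh_sq ((e%:C : C) - w).
  move=> e1; rewrite leNgt; apply/negP => h.
  have /nbhs_normcP[d d0 hd] := near_sinh_sq_lt h.
  have e_gt : 1 < `|e * (1 + d / 2)|.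
    by rewrite normrM e1 mul1r ger0_norm; lra.
  have := Hout ((e * (1 + d / 2))%:C : C) erefl e_gt.
  apply/negP; rewrite -leNgt ltW//; apply: hd.
  rewrite (_ : _ - _ = (e * (d / 2))%:C).
    by rewrite normc_realC normrM e1 mul1r ger0_norm; lra.
  by rewrite -rmorphB/=; congr (_%:C); ring.
split; left; split; rewrite ?lower_capE//.
- exact: unit_segment1.
- by move=> [+ _]; apply/negP; rewrite -leNgt; exact: (end_notin 1 (normr1 _)).
- exact: unit_segmentN1.
- move=> [+ _]; apply/negP; rewrite -leNgt.
  by rewrite -(rmorphN1 (real_complex R)) end_notin ?normrN1.
Qed.

Lemma alpha_bstar_upper a w x : 0 <= a ->
  (forall x, Im x = 0 -> 1 < `|Re x| -> sinh a ^+ 2 < sinh_sq (x - w)) ->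
  0 < Im x -> 0 <= alpha (bstar a w) x.
Proof.
move=> a0 Hout x0; have bb := bstar_branch a0 Hout.
have [b1 bN1] := bstar_endpoints a0 Hout.
rewrite /alpha.
have -> : sqrt_branch (bstar a w) x =
    flipped_root (fun x => lower_cap a w x /\ Im x < 0) x.
  apply: (@sqrt_branch_unique _ _ _ _ x (0 +i* 1) (sqrt_branchP bb) bb _ b1 bN1).
    by rewrite normc_imC normr1.
  by move=> t t0; apply: bstar_not_upper => /=; lra.
rewrite /flipped_root flip_false ?rmorph1 ?mul1r.
  exact/ln_ge0/normc_quadrant_root_ge1.
by move=> [_]; rewrite ltNge ltW.
Qed.

Lemma alpha_bstar_norm a w x : 0 <= a ->
  (forall x, Im x = 0 -> 1 < `|Re x| -> sinh a ^+ 2 < sinh_sq (x - w)) ->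
  `|alpha (bstar a w) x| = alpha unit_segment x.
Proof.
move=> a0 Hout; have bb := bstar_branch a0 Hout.
have h : cosh `|alpha (bstar a w) x| = cosh (alpha unit_segment x).
  by rewrite cosh_norm cosh_alpha_segment; exact: cosh_alpha bb.
apply/eqP; rewrite eq_le.
rewrite -(ler_cosh (normr_ge0 _) (alpha_segment_ge0 x)).
by rewrite -(ler_cosh (alpha_segment_ge0 x) (normr_ge0 _)) h lexx.
Qed.

End ShiftedEllipse.

(** * The effect of the shift *)

Section Decrease.
Context {R : realType}.
Local Open Scope complex_scope.
Local Notation C := (Cplx R).
Local Notation Re := complex.Re.
Local Notation Im := complex.Im.
Implicit Types (x y w : C) (a : R).

Lemma ler_of_sqr (u v : R) : 0 <= v -> u ^+ 2 <= v ^+ 2 -> u <= v.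
Proof. by move=> v0 uv; rewrite leNgt; apply/negP => vu; nra. Qed.

Lemma sinh_sq_mono x y : Re x ^+ 2 <= Re y ^+ 2 -> Im x ^+ 2 <= Im y ^+ 2 ->
  sinh_sq x <= sinh_sq y.
Proof.
move=> hR hI; have := sinh_sq_root y => /=; have := sinh_sq_ge0 y.
rewrite le_eqVlt => /predU1P[y0 _|y0 hy]; last first.
  by apply: sinh_sq_le => //; nra.
have := le_sinh_sq_Im y; have := root_im_arg_ge0 y; rewrite -y0 => h1 h2.
have x0 : Im x = 0 by apply/eqP; rewrite -sqrf_eq0; apply/eqP; have := sqr_ge0 (Im x); lra.
by rewrite sinh_sq_real//; nra.
Qed.

Lemma sinh_sq_lt_Re x y : Re x ^+ 2 < Re y ^+ 2 -> Im x ^+ 2 = Im y ^+ 2 ->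
  Im x != 0 -> sinh_sq x < sinh_sq y.
Proof.
move=> hR hI x0; have /= hx := sinh_sq_root x; have /= hy := sinh_sq_root y.
have i0 : 0 < Im x ^+ 2 by rewrite exprn_even_gt0.
have := le_sinh_sq_Im x; have := le_sinh_sq_Im y; rewrite -hI => h1 h2.
rewrite -hI in hy; rewrite ltNge; apply/negP => h3.
have ty0 : 0 < sinh_sq y by lra.
have AB : sinh_sq y + 1 - Re y ^+ 2 - Im x ^+ 2 <
  sinh_sq x + 1 - Re x ^+ 2 - Im x ^+ 2 by lra.
have A0 : 0 < sinh_sq y + 1 - Re y ^+ 2 - Im x ^+ 2 by rewrite -(pmulr_rgt0 _ ty0) hy.
have := ler_wpM2r (ltW (lt_trans A0 AB)) h3; rewrite hx.
have : sinh_sq y * (sinh_sq y + 1 - Re y ^+ 2 - Im x ^+ 2) <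
  sinh_sq y * (sinh_sq x + 1 - Re x ^+ 2 - Im x ^+ 2) by rewrite ltr_pM2l.
by rewrite hy; lra.
Qed.

(** The square of [sinh] of [alpha_max_pole]. As alpha_max of the remainder is no larger, the
    condition [sinh a ^+ 2 <= sinh_sq_edge eta omega] covers both kinds of terms. *)
Definition sinh_sq_edge (eta omega : R) : R :=
  sinh_sq ((1 - `|omega|) +i* eta : C).

Lemma sinh_sq_edgeE (eta omega : R) : let t := sinh_sq_edge eta omega in
  t ^+ 2 + t * (2 * `|omega| - `|omega| ^+ 2 - eta ^+ 2) = eta ^+ 2.
Proof.
by have /= := sinh_sq_root ((1 - `|omega|) +i* eta : C); rewrite /sinh_sq_edge; lra.
Qed.

Lemma sinh_sq_edge_gt0 (eta omega : R) : 0 < eta -> 0 < sinh_sq_edge eta omega.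
Proof.
move=> e0; apply: lt_le_trans (le_sinh_sq_Im _); by rewrite /= exprn_gt0.
Qed.

(** For a smaller t one has [t^2 + 2 t |omega| < eta^2], while the edge equation makes the left side
    at least [eta^2]. *)
Lemma sinh_sq_edge_ge (c eta omega : R) : 0 < c -> 0 < eta -> `|omega| <= c * eta ->
  (1 + 2 * c)^-1 * eta <= sinh_sq_edge eta omega.
Proof.
move=> c0 e0 hw; have := sinh_sq_edgeE eta omega => /=.
have := sinh_sq_edge_gt0 omega e0; move: (sinh_sq_edge _ _) => t t0.
have d0 : 0 < (1 + 2 * c)^-1 by rewrite invr_gt0; lra.
have hd : (1 + 2 * c)^-1 * (1 + 2 * c) = 1 by rewrite mulVf// lt0r_neq0//; lra.
move: (_^-1) d0 hd => d d0 hd; have := normr_ge0 omega.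
move: `|omega| hw => W hw W0 hE; rewrite leNgt; apply/negP => ht.
have h1 : t * W <= (d * eta) * (c * eta) by apply: ler_pM => //; exact: ltW.
have h2 : t ^+ 2 < (d * eta) ^+ 2 by rewrite ltr_pXn2r ?nnegrE ?ltW ?mulr_gt0.
have d1 : d <= 1 by nra.
have h3 : (d * eta) ^+ 2 <= d * eta ^+ 2.
  by rewrite exprMn expr2 -mulrA ler_piMl// mulr_ge0 ?sqr_ge0// ltW.
have h4 : 0 <= t * W ^+ 2 by rewrite mulr_ge0 ?sqr_ge0 ?ltW.
have h5 : 0 <= t * eta ^+ 2 by rewrite mulr_ge0 ?sqr_ge0 ?ltW.
have h6 : d * eta ^+ 2 + 2 * (d * eta * (c * eta)) = eta ^+ 2.
  by apply: (@eq_trans _ _ (d * (1 + 2 * c) * eta ^+ 2)); [ring|rewrite hd mul1r].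
lra.
Qed.

Lemma sinh_sq_edge_le (eta omega : R) : 0 < eta <= 1 -> `|omega| <= 1 ->
  sinh_sq_edge eta omega <= 2 * eta.
Proof.
move=> /andP[e0 e1] hw; have := sinh_sq_edgeE eta omega => /=.
have := sinh_sq_edge_gt0 omega e0; move: (sinh_sq_edge _ _) => t t0.
have := normr_ge0 omega; move: `|omega| hw => W hw W0 hE.
rewrite leNgt; apply/negP => ht.
have h1 : 0 <= t * (2 * W - W ^+ 2) by apply: mulr_ge0; [exact: ltW|nra].
have h2 : t * eta ^+ 2 <= t * eta by rewrite ler_pM2l// expr2 ler_piMl// ltW.
have h3 : 0 <= t * eta by rewrite mulr_ge0// ltW.
nra.
Qed.

(** A perturbation of the quadratic equation. At level [r ^+ 2] the shifted point satisfies the test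
    of [sinh_sq_le] with slack [k * V * eta]; lowering the level by [d * eta * r] uses up at most
    this slack. Here [t1] stands for [sinh_sq_edge eta omega]. *)
Lemma shift_decrease_edge (c c2 k d eta omega r X V t1 : R) :
  0 < c -> 0 < c2 -> c2 ^+ 2 = 2 * k -> 0 < k < 1 -> 0 < d < 1 ->
  d * (4 + 4 * c) = k -> 0 < eta < 1 / 2 ->
  eta * (4 * c ^+ 2 + 2 + 4 * c) < k -> `|omega| <= c * eta ->
  0 < r -> r ^+ 2 <= t1 -> c2 * eta <= t1 -> t1 <= 2 * eta ->
  t1 ^+ 2 + t1 * (2 * `|omega| - `|omega| ^+ 2 - eta ^+ 2) = eta ^+ 2 ->
  r ^+ 2 * (r ^+ 2 + 1 - X ^+ 2 - V ^+ 2) = V ^+ 2 -> eta <= V ->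
  let T := r ^+ 2 - d * eta * r in
  0 < T /\ (V - eta) ^+ 2 <= T * (T + 1 - (X + omega) ^+ 2 - (V - eta) ^+ 2).
Proof.
move=> c0 c20 c2k /andP[k0 k1] /andP[d0 d1] dk /andP[eta0 eta_half] hk hw.
move=> r0 hr t1_ge t1_le t1E hX hV T.
have TE : T = r ^+ 2 - d * eta * r by [].
clearbody T.
have om2 : omega ^+ 2 = `|omega| ^+ 2 by rewrite real_normK ?num_real.
have Xom : `|X * omega| = `|omega| * `|X| by rewrite normrM mulrC.
have W0 := normr_ge0 omega.
move: `|omega| W0 hw om2 Xom t1E => W W0 hw om2 Xom t1E.
have r1 : r < 1 by clear -hr t1_le eta_half r0; nra.
have V0 : 0 < V by clear -hV eta0; lra.
have Vr : V <= r.
  by apply: ler_of_sqr; [exact: ltW|clear -hX r0; have := sqr_ge0 X; nra].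
have hVr : V ^+ 2 / r <= V by rewrite ler_pdivrMr// expr2 ler_pM2l.
have XrE : X ^+ 2 <= r ^+ 2 + 1.
  have : 0 <= r ^+ 2 * (r ^+ 2 + 1 - X ^+ 2).
    by clear -hX; have := sqr_ge0 V; have := sqr_ge0 (r * V); lra.
  by rewrite pmulr_rge0 ?exprn_gt0// subr_ge0.
have Xe : `|X| <= 1 + eta.
  apply: ler_of_sqr; first by clear -eta0; lra.
  rewrite real_normK ?num_real//.
  by clear -XrE hr t1_le eta0; have := sqr_ge0 eta; lra.
have {Xom} : `|X * omega| <= W * (1 + eta) by rewrite Xom ler_wpM2l.
move=> /ler_normlP[Xw Xw2].
have W2 : W ^+ 2 <= c ^+ 2 * eta ^+ 2.
  by rewrite -exprMn ler_pXn2r ?nnegrE// mulr_ge0// ltW.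
have t10 : 0 < t1 by apply: lt_le_trans hr; rewrite exprn_gt0.
have We0 : 0 <= W * (1 + eta) by apply: mulr_ge0 => //; clear -eta0; lra.
(* Cost of the horizontal shift. As [r ^+ 2 <= t1], the edge equation bounds it by
   [eta ^+ 2 - t1 ^+ 2] plus terms of higher order. Of [t1 ^+ 2 >= 2 * k * eta ^+ 2], one half pays
   for these terms and the other half is kept. *)
have step5 : 2 * (W * (1 + eta)) * r ^+ 2 + W ^+ 2 * r ^+ 2 <= eta ^+ 2 * (1 - k).
  have h1 : (2 * (W * (1 + eta)) + W ^+ 2) * r ^+ 2 <=
      (2 * (W * (1 + eta)) + W ^+ 2) * t1.
    apply: ler_wpM2l => //; apply: addr_ge0 (sqr_ge0 _).
    by clear -We0; lra.
  have h2 : 2 * k * eta ^+ 2 <= t1 ^+ 2.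
    rewrite (_ : 2 * k * eta ^+ 2 = (c2 * eta) ^+ 2); last by rewrite exprMn c2k.
    by rewrite ler_pXn2r ?nnegrE ?mulr_ge0 ?(ltW c20) ?(ltW eta0) ?(ltW t10).
  have h3 : t1 * (2 * W ^+ 2 + eta ^+ 2 + 2 * W * eta) <= k * eta ^+ 2.
    have h4 : W * eta <= c * eta * eta by rewrite ler_pM2r.
    have h5 : 0 <= W * eta by apply: mulr_ge0 => //; exact: ltW.
    apply: (@le_trans _ _ (2 * eta * ((2 * c ^+ 2 + 1 + 2 * c) * eta ^+ 2))).
      apply: ler_pM => //; first exact: ltW.
        by clear -h5; have := sqr_ge0 W; have := sqr_ge0 eta; lra.
      by clear -W2 h4; lra.
    rewrite (_ : _ * _ = (eta * (4 * c ^+ 2 + 2 + 4 * c)) * eta ^+ 2); last by ring.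
    by apply: ler_wpM2r; [exact: sqr_ge0|exact: ltW].
  by clear -h1 h2 h3 t1E; lra.
(* The vertical shift gains [2 V eta - eta^2]. Subtracting the cost [(1 - k) eta^2] leaves
   [k V eta + (2 - k) eta (V - eta)], and [eta <= V]. *)
have step6 : k * V * eta <=
    r ^+ 2 * (r ^+ 2 + 1 - (X + omega) ^+ 2 - (V - eta) ^+ 2) - (V - eta) ^+ 2.
  have h1 : 0 <= (2 * V * eta - eta ^+ 2) * r ^+ 2.
    apply: mulr_ge0 (sqr_ge0 _); rewrite expr2 -mulrBl.
    by apply: mulr_ge0; [clear -V0 hV; lra|exact: ltW].
  have h2 : X * omega * r ^+ 2 <= W * (1 + eta) * r ^+ 2.
    by rewrite ler_wpM2r ?sqr_ge0.
  have h3 : 0 <= (2 - k) * eta * (V - eta).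
    apply: mulr_ge0; last by rewrite subr_ge0.
    by apply: mulr_ge0; [clear -k1; lra|exact: ltW].
  have om2r : omega ^+ 2 * r ^+ 2 = W ^+ 2 * r ^+ 2 by rewrite om2.
  by clear -step5 h1 h2 h3 om2r hX; lra.
(* The second factor is the derivative of the quadratic at level [r ^+ 2]. Its main part is
   rewritten by the ellipse equation as [r (1 - X^2 - V^2) = V^2 / r - r^3], which is at most V
   because [V <= r]. *)
have step7 : r * (2 * r ^+ 2 + 1 - (X + omega) ^+ 2 - (V - eta) ^+ 2) <=
    (4 + 4 * c) * V.
  have e1 : r * (1 - X ^+ 2 - V ^+ 2) = V ^+ 2 / r - r ^+ 3.
    have -> : V ^+ 2 / r = r * (r ^+ 2 + 1 - X ^+ 2 - V ^+ 2).
      by rewrite -[X in X / r]hX; field; exact: lt0r_neq0.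
    by ring.
  have h2 : r * - (X * omega) <= r * (W * (1 + eta)) by rewrite ler_pM2l.
  have h3 : r * (W * (1 + eta)) <= 1 * (c * V * 2).
    apply: ler_pM => //; [exact: ltW|exact: ltW|].
    apply: ler_pM => //; [clear -eta0; lra| |clear -eta_half; lra].
    by apply: le_trans hw _; rewrite ler_pM2l.
  have h4 : r * (V * eta) <= 1 * (V * (1 / 2)).
    have Ve0 : 0 <= V * eta by apply: mulr_ge0; exact: ltW.
    by apply: ler_pM => //; [exact: ltW|exact: ltW|rewrite ler_pM2l// ltW].
  have h5 : r * r ^+ 2 <= 1 * (2 * V).
    apply: ler_pM; [exact: ltW|exact: sqr_ge0|exact: ltW|].
    by clear -hr t1_le hV; lra.
  have h6 : 0 <= r * W ^+ 2 by apply: mulr_ge0 (sqr_ge0 _); exact: ltW.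
  have h7 : 0 <= r * eta ^+ 2 by apply: mulr_ge0 (sqr_ge0 _); exact: ltW.
  have e2 : r * (2 * r ^+ 2 + 1 - (X + omega) ^+ 2 - (V - eta) ^+ 2) =
      2 * r ^+ 3 + r * (1 - X ^+ 2 - V ^+ 2) + 2 * (r * - (X * omega))
      - r * omega ^+ 2 + 2 * (r * (V * eta)) - r * eta ^+ 2 by ring.
  have e3 : r * r ^+ 2 = r ^+ 3 by ring.
  rewrite e2 e1 om2; clear -h2 h3 h4 h5 h6 h7 e3 hVr; lra.
have T0 : 0 < T.
  rewrite TE (_ : _ - _ = r * (r - d * eta)); last by ring.
  rewrite mulr_gt0// subr_gt0; apply: lt_le_trans Vr; apply: lt_le_trans hV.
  by rewrite gtr_pMl.
split=> //.
have Tr : T <= r ^+ 2.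
  have : 0 <= d * eta * r by apply: mulr_ge0; [apply: mulr_ge0|]; exact: ltW.
  by rewrite TE; clear; lra.
set Q := (X + omega) ^+ 2 in step6 step7 *.
set Y := (V - eta) ^+ 2 in step6 step7 *.
have e1 : T * (T + 1 - Q - Y) = r ^+ 2 * (r ^+ 2 + 1 - Q - Y)
   - d * eta * (r * (r ^+ 2 + T + 1 - Q - Y)) by rewrite TE; ring.
have h1 : r * (r ^+ 2 + T + 1 - Q - Y) <= (4 + 4 * c) * V.
  by apply: le_trans step7; rewrite ler_pM2l//; clear -Tr; lra.
have h2 : d * eta * (r * (r ^+ 2 + T + 1 - Q - Y)) <= d * eta * ((4 + 4 * c) * V).
  by rewrite ler_pM2l ?mulr_gt0.
have h3 : d * eta * ((4 + 4 * c) * V) = k * V * eta by rewrite -dk; ring.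
rewrite e1; clear -h2 h3 step6; lra.
Qed.

(* Moving the point X - i V of the lower arc of the ellipse by omega + i eta
   decreases its parameter. The point 1 - |omega| + i eta lies outside the
   ellipse, and this is what bounds the effect of the horizontal shift. *)
Lemma shift_decrease (c : R) : 0 < c ->
  exists2 d : R, 0 < d & \forall eta \near 0^'+, forall omega r X V : R,
    `|omega| <= c * eta -> 0 < r -> r ^+ 2 <= sinh_sq_edge eta omega ->
    r ^+ 2 * (r ^+ 2 + 1 - X ^+ 2 - V ^+ 2) = V ^+ 2 -> eta <= V ->
    let T := r ^+ 2 - d * eta * r in
    0 < T /\ (V - eta) ^+ 2 <= T * (T + 1 - (X + omega) ^+ 2 - (V - eta) ^+ 2).
Proof.
(* [c2] is the constant of [sinh_sq_edge_ge], so that [t1 ^+ 2 >= 2 * k * eta ^+ 2]; below, [d]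
   makes the loss [d * (4 + 4 * c)] equal to the slack [k]. *)
move=> c0; pose c2 : R := (1 + 2 * c)^-1; pose k := c2 ^+ 2 / 2.
have c2_gt0 : 0 < c2 by rewrite invr_gt0; lra.
have c2_lt1 : c2 < 1 by rewrite invf_lt1; lra.
have k0 : 0 < k by rewrite /k divr_gt0// exprn_gt0.
have k1 : k < 1 by rewrite /k; nra.
pose d := k / (4 + 4 * c).
have d0 : 0 < d by rewrite /d divr_gt0//; lra.
have dk : d * (4 + 4 * c) = k by rewrite /d divfK//; lra.
have d1 : d < 1 by nra.
have c2k : c2 ^+ 2 = 2 * k by rewrite /k; field.
have q0 : 0 < 4 * c ^+ 2 + 2 + 4 * c by nra.
exists d => //; near=> eta.
have eta0 : 0 < eta by near: eta; exact: nbhs_right_gt.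
have eta_half : eta < 1 / 2 by near: eta; exact: nbhs_right_lt.
have eta_c : eta < c^-1 by near: eta; apply: nbhs_right_lt; rewrite invr_gt0.
have eta_k : eta < k / (4 * c ^+ 2 + 2 + 4 * c).
  by near: eta; apply: nbhs_right_lt; exact: divr_gt0.
move=> omega r X V hw r0 hr hX hV.
have W1 : `|omega| <= 1.
  by apply: le_trans hw _; rewrite mulrC -ler_pdivlMr// mul1r ltW.
have e1 : 0 < eta <= 1.
  by rewrite eta0 (le_trans (ltW eta_half))// ler_pdivrMr// mul1r ler1n.
apply: (shift_decrease_edge c0 c2_gt0 c2k _ _ dk _ _ hw r0 hr) => //.
- by rewrite k0.
- by rewrite d0.
- by rewrite eta0.
- by rewrite -ltr_pdivlMr.
- exact: sinh_sq_edge_ge.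
- exact: sinh_sq_edge_le.
- exact: sinh_sq_edgeE.
Unshelve. all: by end_near. Qed.

End Decrease.

(** * Bounds on alpha_min *)

Section MinAlpha.
Context {R : realType}.
Local Open Scope complex_scope.
Local Notation C := (Cplx R).
Local Notation Re := complex.Re.
Local Notation Im := complex.Im.
Implicit Types (x y w : C) (a eta omega : R).

(* The shifted ellipse meets the real line within [-1, 1]: this is why [bstar]
   joins -1 to 1. *)
Lemma shifted_ellipse_real a eta omega : 0 < eta -> `|omega| < 1 ->
  sinh a ^+ 2 <= sinh_sq_edge eta omega ->
  forall x, Im x = 0 -> 1 < `|Re x| ->
  sinh a ^+ 2 < sinh_sq (x - (omega +i* eta : C)).
Proof.
move=> e0 w1 ha x x0 x1; apply: le_lt_trans ha _; apply: sinh_sq_lt_Re.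
- have h : 1 - `|omega| < `|Re x - omega|.
    by have := lerB_dist (Re x) omega; lra.
  case: (x) h => u v /= h; rewrite -[X in _ < X]real_normK ?num_real//.
  by rewrite ltr_pXn2r ?nnegrE//; lra.
- by case: (x) x0 => u v /= ->; rewrite sub0r sqrrN.
- by rewrite /= lt0r_neq0.
Qed.

(** With b the parameter of [x], the difference of the squares of [sinh] equals that of [cosh], at
    most [4 a (a - b) * 10 <= 80 sinh a (a - b)] since [cosh a <= 5] and [a <= 2 sinh a]. The factor
    [sinh a] cancels: the parameter drops by order eta. *)
Lemma alpha_segment_le_sub a (d eta : R) x : 0 < a <= 1 ->
  sinh_sq x <= sinh a ^+ 2 - d * eta * sinh a ->
  0 < d * eta -> alpha unit_segment x <= a - d / 80 * eta.
Proof.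
move=> /andP[a0 a1]; rewrite -sinh_alpha_segment.
have := alpha_segment_ge0 x; move: (alpha unit_segment x) => b b0 hb de0.
have ha := half_le_sinh (ltW a0).
have r0 : 0 < sinh a by apply: lt_le_trans ha; rewrite divr_gt0.
have rde : 0 < d * eta * sinh a by rewrite mulr_gt0.
have ba : b <= a.
  by rewrite -ler_sqr_sinh ?(ltW a0)//; lra.
have ca : cosh a <= 5.
  have a01 : (0 : R) <= 0 <= a by rewrite lexx ltW.
  have := cosh_sub_le a01 a1; rewrite {2}/cosh oppr0 expR0 => h.
  have : a * a <= 1 by rewrite mulr_ile1// ltW.
  by clear -h; lra.
have bab : 0 <= b <= a by rewrite b0 ba.
have h1 := cosh_sub_le bab a1.
have h2 : d * eta * sinh a <= (cosh a - cosh b) * (cosh a + cosh b).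
  by rewrite -subr_sqr !coshE; clear -hb; lra.
have cab : cosh b <= cosh a by rewrite ler_cosh// ltW.
have h3 : (cosh a - cosh b) * (cosh a + cosh b) <= (4 * a * (a - b)) * 10.
  apply: ler_pM => //; last by clear -ca cab; lra.
    by rewrite subr_ge0.
  by rewrite addr_ge0 ?ltW ?cosh_gt0.
have h4 : (4 * a * (a - b)) * 10 <= 80 * sinh a * (a - b).
  rewrite (_ : _ * 10 = (40 * a) * (a - b)); last by ring.
  by rewrite ler_wpM2r ?subr_ge0//; clear -ha; lra.
have h5 : sinh a * (d * eta) <= sinh a * (80 * (a - b)).
  by have := le_trans h2 (le_trans h3 h4); lra.
by rewrite ler_pM2l// in h5; lra.
Qed.

(** Without convergence [lim] takes the default value 0, which a nonpositive [m] also bounds from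
    below. Thus existence of the boundary values need not be established here. *)
Lemma alpha_above_ge (b : set C) x (m : R) : m <= 0 ->
  (\forall t \near 0^'+, m <= alpha b (x + (0 +i* t : C))) ->
  m <= alpha_above b x.
Proof.
move=> m0 h; rewrite /alpha_above.
have [c|nc] := pselect (cvg (alpha b (x + (0 +i* t : C)) @[t --> (0 : R)^'+])).
  exact: limr_ge.
by rewrite dvgP.
Qed.

Definition bstar_values a w : set R :=
  [set alpha_above (bstar a w) (x + w) | x in frontier (ellipse a)].

Lemma min_alpha_ge (c : R) : 0 < c ->
  exists2 d : R, 0 < d & \forall eta \near 0^'+, forall omega a : R,
    `|omega| <= c * eta -> 0 < a -> sinh a ^+ 2 <= sinh_sq_edge eta omega ->
    lbound (bstar_values a (omega +i* eta : C)) (Num.min 0 (d * eta - a)).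
Proof.
move=> c0; have [d d0 Hd] := shift_decrease c0; exists (d / 80).
  by rewrite divr_gt0.
near=> eta; move=> omega a hw a0 ha.
have e0 : 0 < eta by near: eta; exact: nbhs_right_gt.
have e8 : eta < 1 / 8 by near: eta; apply: nbhs_right_lt.
have ec : eta < c^-1 by near: eta; apply: nbhs_right_lt; rewrite invr_gt0.
have w1 : `|omega| < 1.
  by apply: le_lt_trans hw _; rewrite mulrC -ltr_pdivlMr// mul1r.
have r0 : 0 < sinh a by apply: lt_le_trans (half_le_sinh (ltW a0)); rewrite divr_gt0.
have a1 : a <= 1.
  have := half_le_sinh (ltW a0).
  have : sinh_sq_edge eta omega <= 2 * eta.
    by apply: sinh_sq_edge_le; [rewrite e0; lra|exact: ltW].
  nra.
have Hout := shifted_ellipse_real e0 w1 ha.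
rewrite /bstar_values; set w := (omega +i* eta : C) in Hout *.
move=> _ [x xf <-]; have xE := frontier_ellipse (ltW a0) xf.
(* Such a point lands on or above the real axis, so the approach from above runs in the open upper
   half-plane. *)
have [xe|xe] := leP (- eta) (Im x).
  apply: (@le_trans _ _ 0); first by rewrite ge_min lexx.
  apply: alpha_above_ge => //; near=> t.
  apply: alpha_bstar_upper (ltW a0) Hout _.
  have t0 : 0 < t by near: t; exact: nbhs_right_gt.
  by move: xe; rewrite /w; case: (x) => u v /=; lra.
apply: (@le_trans _ _ (Num.min 0 (d / 80 * eta - a))) => //.
apply: alpha_above_ge; first by rewrite ge_min lexx.
near=> t.
have t0 : 0 < t by near: t; exact: nbhs_right_gt.
have tV : t < - Im x - eta by near: t; apply: nbhs_right_lt; lra.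
have hy : sinh_sq (x + w) <= sinh a ^+ 2 - d * eta * sinh a.
  have := sinh_sq_root x; rewrite /= xE => hx.
  have [|||T0 hT] := near Hd eta _ omega (sinh a) (Re x) (- Im x) hw r0 ha.
  - by [].
  - by rewrite sqrrN hx.
  - by lra.
  apply: sinh_sq_le => //.
  move: hT; rewrite /w; case: (x) => u v /=.
  by rewrite (_ : (- v - eta) ^+ 2 = (v + eta) ^+ 2)//; ring.
(* As [t] is less than the depth of the shifted point, moving up by [t] only brings it closer to the
   axis and lowers its parameter further. *)
have hz : sinh_sq (x + w + (0 +i* t : C)) <= sinh_sq (x + w).
  apply: sinh_sq_mono; rewrite /w; have := xe; have := tV; case: (x) => u v /= ? ?.
    by rewrite addr0.
  nra.
have de0 : 0 < d * eta by rewrite mulr_gt0.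
have a01 : 0 < a <= 1 by rewrite a0.
have := alpha_segment_le_sub a01 (le_trans hz hy) de0.
rewrite -(alpha_bstar_norm _ (ltW a0) Hout) => /ler_normlP[h _].
by rewrite ge_min; apply/orP; right; lra.
Unshelve. all: by end_near. Qed.

End MinAlpha.

(** * The upper bound on alpha_min *)

Section MinAlphaBounds.
Context {R : realType}.
Local Open Scope complex_scope.
Local Notation C := (Cplx R).
Local Notation Re := complex.Re.
Local Notation Im := complex.Im.
Implicit Types (x y w : C) (a eta omega : R).

Lemma sinh_sq_imag x : Re x = 0 -> sinh_sq x = Im x ^+ 2.
Proof.
move=> /root_re_eq0 x0; have := sqr_root_re x; rewrite x0 expr0n/=; lra.
Qed.

Lemma alpha_segment_continuous x : Im x != 0 ->
  {for x, continuous (alpha (@unit_segment R))}.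
Proof.
move=> x0; have [sE sC _] := sqrt_branchP (@unit_segment_branch R).
have FF : Filter (nbhs x) := nbhs_filter x.
have xs : ~ unit_segment x by move=> /unit_segmentE[/eqP]; rewrite (negbTE x0).
have xC : (fun y : C => y) @ x --> x by [].
have h := cvg_normc (cvg_cplxD xC (sC _ xs)).
have p0 : 0 < normc (x + sqrt_branch unit_segment x).
  have := normc_sqrt_branchM (sE x); have := normc_ge0 (x + sqrt_branch unit_segment x).
  by rewrite le_eqVlt => /predU1P[<-|//]; rewrite mul0r => /eqP; rewrite eq_sym oner_eq0.
exact: continuous_cvg _ (continuous_ln p0) (h _ _).
Qed.

Lemma bottom_frontier a : 0 < a ->
  frontier (ellipse a) (0 +i* (- sinh a) : C).
Proof.
move=> a0; have r0 : 0 < sinh a.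
  by apply: lt_le_trans (half_le_sinh (ltW a0)); rewrite divr_gt0.
split.
  move=> A /nbhs_normcP[e e0 eA]; pose t := Num.min (e / 2) (sinh a).
  have t0 : 0 < t by rewrite lt_min divr_gt0.
  have te : t <= e / 2 by rewrite ge_min lexx.
  have tr : t <= sinh a by rewrite ge_min lexx orbT.
  exists (0 +i* (t - sinh a)); split.
    by apply/ellipseE; [exact: ltW|rewrite sinh_sq_imag//=; nra].
  apply: eA; rewrite (_ : _ - _ = (0 +i* t : C)).
    by rewrite normc_imC gtr0_norm//; lra.
  by rewrite addcE/= oppr0 addr0 opprK subrK.
move=> /(@interior_subset C) /(ellipseE _ (ltW a0)); rewrite sinh_sq_imag//= sqrrN.
by rewrite ltxx.
Qed.

(** Test the infimum at the image p of the lowest point of the ellipse. The [sinh] of its parameter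
    is at least its depth [sinh a - eta], and [subr_le_sinh] turns this loss eta into a loss of at
    most [2 * eta] in the parameter. *)
Lemma min_alpha_le a eta omega : 0 < eta -> `|omega| < 1 -> 0 < a ->
  sinh a ^+ 2 <= sinh_sq_edge eta omega -> eta < sinh a ->
  has_lbound (bstar_values a (omega +i* eta : C)) ->
  a + min_alpha a (omega +i* eta : C) <= 2 * eta.
Proof.
move=> e0 w1 a0 ha er; rewrite /min_alpha -/(bstar_values _ _).
set S := bstar_values _ _ => hS.
have Hout := shifted_ellipse_real e0 w1 ha.
set w := (omega +i* eta : C) in Hout *.
pose p : C := (0 +i* (- sinh a) : C) + w.
have pI : Im p = eta - sinh a by rewrite /p /w addcE/= addrC.
have pI0 : Im p < 0 by rewrite pI subr_lt0.
have pS : S (alpha_above (bstar a w) p).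
  by exists (0 +i* (- sinh a)) => //; exact: bottom_frontier.
suff pE : alpha_above (bstar a w) p = - alpha unit_segment p.
  have h := ge_inf hS pS; rewrite pE in h.
  suff : a - alpha unit_segment p <= 2 * eta by lra.
  have := alpha_segment_ge0 p; have := sinh_alpha_segment p.
  have := le_sinh_sq_Im p; move: (alpha _ p) => c hI hc c0.
  have [ca|ca] := leP a c; first by lra.
  have ca' : 0 <= c <= a by rewrite c0 ltW.
  have := subr_le_sinh ca'; have := sinh_ge0 c0; rewrite -hc pI in hI.
  have : sinh a - eta <= sinh c.
    rewrite -(ler_pXn2r (ltn0Sn 1)) ?nnegrE ?subr_ge0 ?(ltW er) ?sinh_ge0//.
    by apply: le_trans hI; rewrite -sqrrN opprB.
  lra.
rewrite /alpha_above; apply: cvg_lim => //.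
have pt t : p + (0 +i* t : C) = (omega +i* (eta - sinh a + t) : C).
  by rewrite /p /w !addcE/= add0r addr0 [- _ + _]addrC.
have t_cvg : t @[t --> (0 : R)^'+] --> (0 : R) by exact: cvg_within.
have c1 : alpha unit_segment (p + (0 +i* t : C)) @[t --> (0 : R)^'+] -->
    alpha unit_segment p.
  have pc : (p + (0 +i* t : C)) @[t --> (0 : R)^'+] --> p.
    rewrite [X in _ --> X](_ : p = p + (0 +i* 0 : C)); last by exact/esym/addr0.
    apply: cvg_cplxD; first exact: cvg_cst.
    by apply: cvg_complex; [exact: cvg_cst|exact: t_cvg].
  by apply: (cvg_comp _ _ pc); apply: alpha_segment_continuous; rewrite ltr0_neq0.
apply: cvg_trans (cvgN c1); apply: near_eq_cvg.
near=> t.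
have t0 : 0 < t by near: t; exact: nbhs_right_gt.
have tr : t < sinh a - eta by near: t; apply: nbhs_right_lt; lra.
have qw (s : R) : (omega +i* (eta - sinh a + s) : C) - w = (0 +i* (s - sinh a) : C).
  by rewrite /w addcE/= subrr; congr (_ +i* _); ring.
have qlt (s : R) : 0 < s -> s <= sinh a - eta ->
    sinh_sq ((omega +i* (eta - sinh a + s) : C) - w) < sinh a ^+ 2.
  by move=> s0 s1; rewrite qw sinh_sq_imag//=; nra.
have bb := bstar_branch (ltW a0) Hout.
have [b1 bN1] := bstar_endpoints (ltW a0) Hout.
suff h : alpha (bstar a w) (p + (0 +i* t : C)) <= 0.
  have := alpha_bstar_norm (p + (0 +i* t : C)) (ltW a0) Hout.
  by rewrite ler0_norm// => E; rewrite -[RHS]opprK E.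
rewrite pt /alpha; set q := (omega +i* _ : C).
have -> : sqrt_branch (bstar a w) q =
    flipped_root (fun x => lower_cap a w x /\ Im x < 0) q.
  apply: (@sqrt_branch_unique _ _ _ _ q (0 +i* 1) (sqrt_branchP bb) bb _ b1 bN1).
    by rewrite normc_imC normr1.
  (* From just above the lowest point, the vertical ray stays inside the shifted ellipse up to the
     real axis and then runs in the upper half-plane, so it never meets the cut. *)
  move=> s s0; rewrite /ray /q/= mulr0 addr0 mulr1.
  have [hI|hI] := ltP 0 (eta - sinh a + t + s); first exact: bstar_not_upper.
  apply: bstar_not_inside => //; first exact: ltW.
  by rewrite -addrA; apply: qlt; lra.
rewrite /flipped_root flip_true; last first.
  by split; [apply/lower_capE; rewrite ?(ltW a0)//; split; [apply: qlt; lra|rewrite /=; lra]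
            |rewrite /=; lra].
rewrite rmorphN1 mulN1r; apply: ln_le0.
have := normc_sqrt_branchM (quadrant_root_sqr q).
have := normc_quadrant_root_ge1 q; have := normc_ge0 (q - quadrant_root q).
by nra.
Unshelve. all: by end_near. Qed.

End MinAlphaBounds.

(** * Cardinality of the truncated index sets *)

Section Counting.
Context {R : realType}.
Implicit Types (tau amax amin : R).

Lemma card_set_le {T : choiceType} (K : set T) (s : seq T) :
  (forall x, K x -> x \in s) -> finite_set K /\ (card_set K <= size s)%N.
Proof.
move=> Ks; have fK : finite_set K.
  by apply: (@sub_finite_set _ _ [set` s]); [move=> x /Ks|exact: finite_seq].
split=> //; apply: uniq_leq_size; first exact: fset_uniq.
by move=> x; rewrite in_fset_set// inE => /Ks.
Qed.

Lemma card_set_ge {T : choiceType} (K : set T) (s : seq T) :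
  finite_set K -> uniq s -> (forall x, x \in s -> K x) -> (size s <= card_set K)%N.
Proof.
by move=> fK us sK; apply: uniq_leq_size => // x /sK Kx; rewrite in_fset_set// inE.
Qed.

Lemma card_set_image_le {T U : choiceType} (f : T -> U) (K : set T) :
  finite_set K -> (card_set (f @` K) <= card_set K)%N.
Proof.
move=> fK; rewrite /card_set -[leqRHS](size_map f).
apply: (card_set_le _).2 => _ [x Kx <-]; apply: map_f.
by rewrite in_fset_set// inE.
Qed.

Lemma matvec_bound_le (K : set (nat * nat)) : finite_set K ->
  (matvec_bound K <= 2 * inner_products K)%N.
Proof.
by move=> fK; rewrite mul2n -addnn leq_add// card_set_image_le.
Qed.

(** In the coordinates |k1 - k2| and min(k1, k2) the index set is a pair of right triangles, which
    makes counting immediate. *)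
Lemma truncationE tau amax amin p : 0 < tau ->
  truncation tau amax amin p <->
  amax * (maxn p.1 p.2 - minn p.1 p.2)%:R + (amax + amin) * (minn p.1 p.2)%:R
    <= - ln tau.
Proof.
move=> tau0; suff e : - alpha_diag amax amin * (p.1%:R + p.2%:R)
    - alpha_anti amax amin * `|p.1%:R - p.2%:R| =
    - (amax * (maxn p.1 p.2 - minn p.1 p.2)%:R + (amax + amin) * (minn p.1 p.2)%:R).
  by rewrite /truncation/= e -{1}(lnK (x := tau)) ?posrE// ler_expR lerNr.
case: p => a b /=; rewrite /alpha_diag /alpha_anti; case: (leqP a b) => [ab|/ltnW ab].
  by rewrite natrB// ler0_norm ?subr_le0 ?ler_nat//; field.
by rewrite natrB// ger0_norm ?subr_ge0 ?ler_nat//; field.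
Qed.

(** Each triangle sits in a box with the same legs; the factor 2 is for the order of k1 and k2, and
    the summands 1 are for rounding. *)
Lemma truncation_card_le tau amax amin : 0 < tau < 1 -> 0 < amax -> 0 < amax + amin ->
  finite_set (truncation tau amax amin) /\
  (card_set (truncation tau amax amin))%:R <=
     2 * ((- ln tau / amax + 1) * (- ln tau / (amax + amin) + 1)) :> R.
Proof.
move=> /andP[tau0 tau1] a0 b0; set L := - ln tau.
have L0 : 0 < L by rewrite oppr_gt0 ln_lt0// tau0.
pose N := (Num.truncn (L / amax)).+1; pose M := (Num.truncn (L / (amax + amin))).+1.
have [nN _] := andP (truncn_itv (ltW (divr_gt0 L0 a0))).
have [nM _] := andP (truncn_itv (ltW (divr_gt0 L0 b0))).
pose s := [seq (d + m, m)%N | d <- iota 0 N, m <- iota 0 M] ++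
          [seq (m, d + m)%N | d <- iota 0 N, m <- iota 0 M].
have sK x : truncation tau amax amin x -> x \in s.
  move=> /(truncationE _ _ _ tau0); rewrite -/L.
  set d := (maxn _ _ - minn _ _)%N; set m := minn _ _ => h.
  have dN : (d < N)%N.
    rewrite ltnS truncn_ge_nat ?(ltW (divr_gt0 L0 a0))// ler_pdivlMr// mulrC.
    by apply: le_trans h; rewrite lerDl mulr_ge0// ltW.
  have mM : (m < M)%N.
    rewrite ltnS truncn_ge_nat ?(ltW (divr_gt0 L0 b0))// ler_pdivlMr// mulrC.
    by apply: le_trans h; rewrite lerDr mulr_ge0// ltW.
  rewrite mem_cat; apply/orP; have [xx|/ltnW xx] := leqP x.1 x.2.
    right; apply/allpairsP; exists (d, m); rewrite !mem_iota/=; split=> //.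
    by rewrite /d /m (maxn_idPr xx) (minn_idPl xx) subnK//; case: (x).
  left; apply/allpairsP; exists (d, m); rewrite !mem_iota/=; split=> //.
  by rewrite /d /m (maxn_idPl xx) (minn_idPr xx) subnK//; case: (x).
have [fK cK] := card_set_le sK; split=> //.
apply: (@le_trans _ _ ((size s)%:R)); first by rewrite ler_nat.
rewrite size_cat !size_allpairs !size_iota addnn -mul2n natrM ler_pM2l// natrM.
by apply: ler_pM => //; rewrite -natr1 lerD2r.
Qed.

(** The box with half the legs lies in the triangle; indices with k1 >= k2 suffice. Finiteness
    matters, since [card_set] is 0 on infinite sets. *)
Lemma truncation_card_ge tau amax amin : 0 < tau < 1 -> 0 < amax -> 0 < amax + amin ->
  (ln tau / 2) ^+ 2 / (amax * (amax + amin)) <=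
  (card_set (truncation tau amax amin))%:R :> R.
Proof.
move=> tau01 a0 b0; have [fK _] := truncation_card_le tau01 a0 b0.
move: tau01 => /andP[tau0 tau1]; set L := - ln tau.
have L0 : 0 < L by rewrite oppr_gt0 ln_lt0// tau0.
have a'0 : 0 < L / (2 * amax) by rewrite divr_gt0// mulr_gt0.
have b'0 : 0 < L / (2 * (amax + amin)) by rewrite divr_gt0// mulr_gt0.
pose N := (Num.truncn (L / (2 * amax))).+1.
pose M := (Num.truncn (L / (2 * (amax + amin)))).+1.
have [nN Nn] := andP (truncn_itv (ltW a'0)); have [nM Mn] := andP (truncn_itv (ltW b'0)).
pose s := [seq (d + m, m)%N | d <- iota 0 N, m <- iota 0 M].
have us : uniq s.
  apply: allpairs_uniq; rewrite ?iota_uniq// => -[d m] [d' m'] _ _ /= [] e1 e2.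
  by congr (_, _) => //; apply/eqP; rewrite -(eqn_add2r m) e1 e2.
have sK x : x \in s -> truncation tau amax amin x.
  move=> /allpairsP[[d m] [+ + ->]]; rewrite -[(d, m).1]/d -[(d, m).2]/m.
  rewrite !mem_iota !add0n !ltnS => /andP[_ dN] /andP[_ mM].
  apply/truncationE => //=; rewrite (maxn_idPl (leq_addl _ _)) (minn_idPr (leq_addl _ _)).
  rewrite addnK -/L.
  have h1 : amax * d%:R <= L / 2.
    have : d%:R <= L / (2 * amax) by apply: le_trans nN; rewrite ler_nat.
    by rewrite ler_pdivlMr ?mulr_gt0//; lra.
  have h2 : (amax + amin) * m%:R <= L / 2.
    have : m%:R <= L / (2 * (amax + amin)) by apply: le_trans nM; rewrite ler_nat.
    by rewrite ler_pdivlMr ?mulr_gt0//; lra.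
  lra.
apply: (@le_trans _ _ ((size s)%:R)); last by rewrite ler_nat card_set_ge.
rewrite size_allpairs !size_iota natrM.
apply: (@le_trans _ _ (L / (2 * amax) * (L / (2 * (amax + amin))))); last first.
  by apply: ler_pM; rewrite ?ltW.
rewrite le_eqVlt; apply/orP; left; apply/eqP; rewrite /L; field.
by rewrite !lt0r_neq0.
Qed.

End Counting.

(** * Sizes of the index sets in terms of eta, beta and k *)

Section CardinalityBounds.
Context {R : realType}.
Local Open Scope complex_scope.
Local Notation C := (Cplx R).
Implicit Types (tau a amin beta eta omega EF : R) (k : nat).

Lemma min_le_add (a e am : R) : Num.min 0 (e - a) <= am -> Num.min a e <= a + am.
Proof. by rewrite !ge_min => /orP[] h; apply/orP; [left|right]; lra. Qed.

(** The bound on [amin] gives [a + amin >= min a (d * eta)], whose inverse is at most the sum of the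
    two inverses. As [a^-1] and [eta^-1] are at least 1, they absorb the rounding terms. *)
Lemma truncation_card_bound tau (d a amin eta : R) : 0 < tau < 1 -> 0 < d ->
  0 < a <= 1 -> 0 < eta <= 1 -> Num.min 0 (d * eta - a) <= amin ->
  finite_set (truncation tau a amin) /\
  (card_set (truncation tau a amin))%:R <=
    2 * ((- ln tau + 1) * (- ln tau + - ln tau / d + 1)) *
    (a^-1 * (a^-1 + eta^-1)).
Proof.
move=> tau01 d0 /andP[a0 a1] /andP[e0 e1] ham; set L := - ln tau.
have L0 : 0 < L by rewrite oppr_gt0 ln_lt0.
have de0 : 0 < d * eta by rewrite mulr_gt0.
have hab := min_le_add ham.
have ab0 : 0 < a + amin by apply: lt_le_trans hab; rewrite lt_min a0.
have [fK cK] := truncation_card_le tau01 a0 ab0; split=> //.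
apply: le_trans cK _; rewrite -/L -mulrA ler_pM2l//.
have ai : 1 <= a^-1 by rewrite invf_ge1.
have ei : 1 <= eta^-1 by rewrite invf_ge1.
have abi : (a + amin)^-1 <= a^-1 + d^-1 * eta^-1.
  move: hab; rewrite ge_min -invfM => /orP[] h.
    rewrite -[leLHS]addr0 lerD ?lef_pV2 ?posrE ?invr_ge0 ?(ltW de0)//.
  by rewrite -[leLHS]add0r lerD ?lef_pV2 ?posrE ?invr_ge0 ?(ltW a0).
have h1 : L / a + 1 <= (L + 1) * a^-1 by rewrite mulrDl mul1r lerD2l.
have h2 : L / (a + amin) + 1 <= (L + L / d + 1) * (a^-1 + eta^-1).
  have := ler_wpM2l (ltW L0) abi; rewrite mulrDr => h.
  have p1 : 0 <= L / d * a^-1 by rewrite !mulr_ge0// ?invr_ge0 ltW.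
  have p2 : 0 <= L * eta^-1 by rewrite !mulr_ge0// ?invr_ge0 ltW.
  have e : L * (d^-1 * eta^-1) = L / d * eta^-1 by rewrite mulrA.
  rewrite e in h; lra.
rewrite [leRHS]mulrACA; apply: ler_pM => //.
  by rewrite addr_ge0// divr_ge0// ltW.
by rewrite addr_ge0// divr_ge0// ltW.
Qed.

(** Nonpositivity covers the convention that the infimum of the empty set is 0. *)
Lemma min_alpha_lower (a m : R) (w : C) : m <= 0 ->
  lbound (bstar_values a w) m ->
  m <= min_alpha a w.
Proof.
move=> m0; rewrite /min_alpha -/(bstar_values a w); move: (bstar_values a w) => S hm.
have [->|/set0P S0] := eqVneq S set0; first by rewrite inf0.
exact: lb_le_inf.
Qed.

Lemma alpha_max_pole_gt0 eta omega : 0 < eta -> 0 < alpha_max_pole eta omega.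
Proof.
move=> e0; rewrite lt_neqAle alpha_segment_ge0 andbT; apply/eqP => h.
have := sinh_sq_edge_gt0 omega e0; rewrite /sinh_sq_edge -sinh_alpha_segment.
by rewrite -[alpha _ _]h /sinh oppr0 subrr mul0r expr0n ltxx.
Qed.

Lemma sinh_alpha_max_pole eta omega :
  sinh (alpha_max_pole eta omega) ^+ 2 = sinh_sq_edge eta omega.
Proof. by rewrite /alpha_max_pole sinh_alpha_segment. Qed.

Lemma sinh_alpha_k_ge beta EF k : 0 < beta ->
  k%:R / beta <= sinh (alpha_k beta EF k).
Proof.
move=> b0.
have s0 : 0 <= sinh (alpha_k beta EF k) by rewrite sinh_ge0// alpha_segment_ge0.
have y0 : 0 <= (2 * k + 1)%:R * pi / beta :> R.
  by rewrite divr_ge0 ?mulr_ge0 ?pi_ge0// ltW.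
apply: (@le_trans _ _ ((2 * k + 1)%:R * pi / beta)).
  rewrite ler_pM2r ?invr_gt0// -[leLHS]mulr1 ler_pM//.
    by rewrite ler_nat (leq_trans (leq_pmull k _) (leq_addr _ _)).
  by have := pi_ge2 R; lra.
rewrite -(ler_pXn2r (ltn0Sn 1)) ?nnegrE//.
rewrite /alpha_k sinh_alpha_segment; exact: (le_sinh_sq_Im (EF +i* _ : C)).
Qed.

(** With [eta <= 1 / 32] the square of [sinh a] is at most [2 * eta <= 1 / 16], so
    [a <= 2 * sinh a <= 1 / 2], the range of [sinh_le]. *)
Lemma small_alpha a eta omega : 0 < eta <= 1 / 32 -> `|omega| <= 1 -> 0 <= a ->
  sinh a ^+ 2 <= sinh_sq_edge eta omega ->
  a <= 1 / 2 /\ sinh a <= 2 * a.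
Proof.
move=> /andP[e0 e1] w1 a0 ha.
have he : sinh_sq_edge eta omega <= 2 * eta.
  by apply: sinh_sq_edge_le => //; rewrite e0; lra.
have h := half_le_sinh a0.
have a1 : a <= 1 / 2.
  by rewrite -(ler_pXn2r (ltn0Sn 1)) ?nnegrE//; nra.
by split=> //; apply: sinh_le; rewrite a0.
Qed.

Lemma K_pole_card tau (c : R) : 0 < tau < 1 -> 0 < c ->
  exists A B : R, [/\ 0 < A, 0 < B & \forall eta \near 0^'+, forall omega,
    `|omega| <= c * eta ->
    [/\ finite_set (K_pole tau eta omega),
        A * (eta * Num.sqrt eta)^-1 <= (card_set (K_pole tau eta omega))%:R
      & (card_set (K_pole tau eta omega))%:R <= B * (eta * Num.sqrt eta)^-1]].
Proof.
move=> tau01 c0; have [d d0 Hd] := min_alpha_ge c0.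
pose c2 : R := (1 + 2 * c)^-1; have c20 : 0 < c2 by rewrite invr_gt0; lra.
have c21 : c2 <= 1 by rewrite invf_le1; lra.
have c2E : (1 + 2 * c)^-1 = c2 by [].
have L0 : 0 < - ln tau by rewrite oppr_gt0 ln_lt0.
pose M := 2 * ((- ln tau + 1) * (- ln tau + - ln tau / d + 1)).
have M0 : 0 < M.
  rewrite /M mulr_gt0// mulr_gt0//; first by lra.
  by rewrite !addr_gt0// divr_gt0.
exists ((ln tau / 2) ^+ 2 / 8), (M * (2 / c2 * (2 / c2 + 1))).
split.
- by rewrite divr_gt0// exprn_even_gt0//= mulf_neq0// ?invr_neq0// -oppr_eq0 lt0r_neq0.
- have h : 0 < 2 / c2 by apply: divr_gt0.
  by apply: mulr_gt0 => //; apply: mulr_gt0 => //; exact: addr_gt0.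
have half1 : 1 / 2 <= 1 :> R by lra.
have small1 : 1 / 32 <= 1 :> R by lra.
near=> eta; move=> omega hw.
have e0 : 0 < eta by near: eta; exact: nbhs_right_gt.
have e32 : eta < 1 / 32 by near: eta; apply: nbhs_right_lt.
have ec : eta < c^-1 by near: eta; apply: nbhs_right_lt; rewrite invr_gt0.
have ec2 : eta < c2 by near: eta; exact: nbhs_right_lt.
have w1 : `|omega| < 1.
  by apply: le_lt_trans hw _; rewrite mulrC -ltr_pdivlMr// mul1r.
have a0 := alpha_max_pole_gt0 omega e0.
have hs : sinh (alpha_max_pole eta omega) ^+ 2 <= sinh_sq_edge eta omega.
  by rewrite sinh_alpha_max_pole.
have hl : lbound (bstar_values (alpha_max_pole eta omega) (omega +i* eta : C))
    (Num.min 0 (d * eta - alpha_max_pole eta omega)).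
  by apply: (near Hd eta).
have m0 : Num.min 0 (d * eta - alpha_max_pole eta omega) <= 0 by rewrite ge_min lexx.
have hmin := min_alpha_lower m0 hl; rewrite -[X in _ <= X]/(alpha_min_pole eta omega) in hmin.
have [a_half sa] : alpha_max_pole eta omega <= 1 / 2 /\
    sinh (alpha_max_pole eta omega) <= 2 * alpha_max_pole eta omega.
  by apply: small_alpha hs; rewrite ?(ltW w1) ?(ltW a0) ?e0 ?(ltW e32).
have he := sinh_sq_edge_ge c0 e0 hw; rewrite c2E -sinh_alpha_max_pole in he.
have he2 : sinh_sq_edge eta omega <= 2 * eta.
  by apply: sinh_sq_edge_le; [rewrite e0 (le_trans (ltW e32))|exact: ltW].
rewrite -sinh_alpha_max_pole in he2.
have ha := half_le_sinh (ltW a0).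
have r0 : 0 < Num.sqrt eta by rewrite sqrtr_gt0.
have rE : Num.sqrt eta ^+ 2 = eta by rewrite sqr_sqrtr// ltW.
have sr : c2 * Num.sqrt eta <= sinh (alpha_max_pole eta omega).
  apply: ler_of_sqr; first exact/sinh_ge0/ltW.
  by rewrite [leLHS]exprMn rE (le_trans _ he)// ler_pM2r// expr2 ler_piMl ?(ltW c20).
have sr2 : sinh (alpha_max_pole eta omega) <= 2 * Num.sqrt eta.
  apply: ler_of_sqr; first by rewrite mulr_ge0// ltW.
  by rewrite [leRHS]exprMn rE (le_trans he2)// ler_pM2r// -natrX ler_nat.
(* From [eta < c2]: then [eta ^+ 2 < c2 * eta], which is at most the square of [sinh]. Hence the
   shifted ellipse still dips below the real axis, as [min_alpha_le] requires. *)
have es : eta < sinh (alpha_max_pole eta omega).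
  rewrite ltNge; apply/negP => h; have := ler_pM (sinh_ge0 (ltW a0)) (sinh_ge0 (ltW a0)) h h.
  by apply/negP; rewrite -ltNge -expr2; apply: lt_le_trans he; rewrite ltr_pM2r//.
have hup : alpha_max_pole eta omega + alpha_min_pole eta omega <= 2 * eta.
  by apply: min_alpha_le => //; eexists; exact: hl.
have a1 : 0 < alpha_max_pole eta omega <= 1 by rewrite a0 (le_trans a_half).
have e1 : 0 < eta <= 1 by rewrite e0 (le_trans (ltW e32)).
have [fK cK] := truncation_card_bound tau01 d0 a1 e1 hmin.
clear hl hs he he2 es hw w1; rewrite /K_pole.
set a := alpha_max_pole eta omega in hmin hup a_half sa ha sr sr2 a0 a1 m0 fK cK *.
set am := alpha_min_pole eta omega in hmin hup fK cK *.
have ab0 : 0 < a + am.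
  by apply: lt_le_trans (min_le_add hmin); rewrite lt_min a0 mulr_gt0.
split=> //.
  apply: le_trans (truncation_card_ge tau01 a0 ab0).
  rewrite -mulrA -invfM ler_wpM2l ?sqr_ge0// lef_pV2 ?posrE ?mulr_gt0//.
  rewrite (_ : 8 * _ = (4 * Num.sqrt eta) * (2 * eta)); last by ring.
  apply: ler_pM => //; [exact: ltW|exact: ltW|].
  have : a <= 2 * sinh a by rewrite -ler_pdivrMl// mulrC.
  move/le_trans; apply; rewrite (natrM _ 2 2) -mulrA.
  by rewrite ler_pM2l.
apply: le_trans cK _; rewrite -/M -[leRHS]mulrA ler_pM2l//.
have ai : a^-1 <= 2 / c2 * (Num.sqrt eta)^-1.
  rewrite (_ : _ * _ = (c2 * Num.sqrt eta / 2)^-1); last first.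
    by field; rewrite !lt0r_neq0.
  rewrite lef_pV2 ?posrE ?divr_gt0 ?mulr_gt0//.
  by rewrite ler_pdivrMr// [leRHS]mulrC (le_trans sr).
have si : (Num.sqrt eta)^-1 <= eta^-1.
  rewrite lef_pV2 ?posrE// -{1}rE expr2 ler_piMr ?(ltW r0)//.
  by rewrite -(ler_pXn2r (ltn0Sn 1)) ?nnegrE ?(ltW r0)// rE expr1n (le_trans (ltW e32)).
have c20' : 0 < 2 / c2 by rewrite divr_gt0.
rewrite (_ : _ * (eta * _)^-1 =
  (2 / c2 * (Num.sqrt eta)^-1) * ((2 / c2 + 1) * eta^-1)); last first.
  by rewrite invfM; ring.
apply: ler_pM => //; rewrite ?invr_ge0 ?(ltW a0)// ?addr_ge0 ?invr_ge0 ?(ltW a0) ?(ltW e0)//.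
rewrite mulrDl mul1r lerD2r; apply: le_trans ai _.
by rewrite ler_pM2l.
Unshelve. all: by end_near. Qed.

(** Uniform in [beta], [EF] and [k], which enter only through [sinh_alpha_k_ge]: whichever term
    attains the minimum in alpha_max, its inverse is of order at most [eta^(-1/2) + beta / k]. *)
Lemma K_rem_card tau (c : R) : 0 < tau < 1 -> 0 < c ->
  exists2 B : R, 0 < B & \forall eta \near 0^'+, forall omega beta EF k,
    `|omega| <= c * eta -> 0 < beta -> (0 < k)%N ->
    finite_set (K_rem tau beta eta omega EF k) /\
    (card_set (K_rem tau beta eta omega EF k))%:R <=
      B * (((Num.sqrt eta)^-1 + beta / k%:R) * (eta^-1 + beta / k%:R)).
Proof.
move=> tau01 c0; have [d d0 Hd] := min_alpha_ge c0.
pose c2 : R := (1 + 2 * c)^-1; have c20 : 0 < c2 by rewrite invr_gt0; lra.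
have c21 : c2 <= 1 by rewrite invf_le1; lra.
have c2E : (1 + 2 * c)^-1 = c2 by [].
have L0 : 0 < - ln tau by rewrite oppr_gt0 ln_lt0.
pose M := 2 * ((- ln tau + 1) * (- ln tau + - ln tau / d + 1)).
have M0 : 0 < M.
  rewrite /M mulr_gt0// mulr_gt0//; first by lra.
  by rewrite !addr_gt0// divr_gt0.
exists (M * (2 / c2 * (2 / c2 + 1))).
  have h : 0 < 2 / c2 by apply: divr_gt0.
  by apply: mulr_gt0 => //; apply: mulr_gt0 => //; exact: addr_gt0.
have half1 : 1 / 2 <= 1 :> R by lra.
have small1 : 1 / 32 <= 1 :> R by lra.
near=> eta; move=> omega beta EF k hw b0 k0.
have e0 : 0 < eta by near: eta; exact: nbhs_right_gt.
have e32 : eta < 1 / 32 by near: eta; apply: nbhs_right_lt.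
have ec : eta < c^-1 by near: eta; apply: nbhs_right_lt; rewrite invr_gt0.
have w1 : `|omega| < 1.
  by apply: le_lt_trans hw _; rewrite mulrC -ltr_pdivlMr// mul1r.
have kb0 : 0 < k%:R / beta :> R by rewrite divr_gt0// ltr0n.
have sk := sinh_alpha_k_ge EF k b0.
have ak0 : 0 < alpha_k beta EF k.
  rewrite lt_neqAle alpha_segment_ge0 andbT; apply/eqP => h.
  by move: (lt_le_trans kb0 sk); rewrite -[alpha_k _ _ _]h /sinh oppr0 subrr mul0r ltxx.
have am0 := alpha_max_pole_gt0 omega e0.
have a0 : 0 < alpha_max_rem beta eta omega EF k by rewrite lt_min am0.
have hs : sinh (alpha_max_rem beta eta omega EF k) ^+ 2 <= sinh_sq_edge eta omega.
  by rewrite -sinh_alpha_max_pole ler_sqr_sinh ?ge_min ?lexx ?(ltW a0) ?(ltW am0).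
have m0 : Num.min 0 (d * eta - alpha_max_rem beta eta omega EF k) <= 0.
  by rewrite ge_min lexx.
have hl : lbound (bstar_values (alpha_max_rem beta eta omega EF k) (omega +i* eta : C))
    (Num.min 0 (d * eta - alpha_max_rem beta eta omega EF k)).
  by apply: (near Hd eta).
have hmin0 := min_alpha_lower m0 hl.
(* The additional minimum with [alpha_k] costs nothing, because [alpha_k] is positive and the bound
   is not. *)
have hmin : Num.min 0 (d * eta - alpha_max_rem beta eta omega EF k) <=
    alpha_min_rem beta eta omega EF k.
  by rewrite /alpha_min_rem le_min hmin0/= (le_trans m0)// ltW.
have [a_half sa] : alpha_max_rem beta eta omega EF k <= 1 / 2 /\
    sinh (alpha_max_rem beta eta omega EF k) <= 2 * alpha_max_rem beta eta omega EF k.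
  by apply: small_alpha hs; rewrite ?(ltW w1) ?(ltW a0) ?e0 ?(ltW e32).
have he := sinh_sq_edge_ge c0 e0 hw; rewrite c2E -sinh_alpha_max_pole in he.
have r0 : 0 < Num.sqrt eta by rewrite sqrtr_gt0.
have rE : Num.sqrt eta ^+ 2 = eta by rewrite sqr_sqrtr// ltW.
have sr : c2 * Num.sqrt eta <= sinh (alpha_max_pole eta omega).
  apply: ler_of_sqr; first exact/sinh_ge0/ltW.
  by rewrite [leLHS]exprMn rE (le_trans _ he)// ler_pM2r// expr2 ler_piMl ?(ltW c20).
have a1 : 0 < alpha_max_rem beta eta omega EF k <= 1 by rewrite a0 (le_trans a_half).
have e1 : 0 < eta <= 1 by rewrite e0 (le_trans (ltW e32)).
have [fK cK] := truncation_card_bound tau01 d0 a1 e1 hmin.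
have c20' : 1 <= 2 / c2 by rewrite ler_pdivlMr// mul1r (le_trans c21)// ler1n.
have bk0 : 0 < beta / k%:R by rewrite divr_gt0// ltr0n.
have bkE : (k%:R / beta)^-1 = beta / k%:R by rewrite invf_div.
have ai : (alpha_max_rem beta eta omega EF k)^-1 <=
    2 / c2 * ((Num.sqrt eta)^-1 + beta / k%:R).
  have sh0 : 0 < sinh (alpha_max_rem beta eta omega EF k).
    by apply: lt_le_trans (half_le_sinh (ltW a0)); rewrite divr_gt0.
  have h : (sinh (alpha_max_rem beta eta omega EF k) / 2)^-1 <=
      2 / c2 * ((Num.sqrt eta)^-1 + beta / k%:R).
    have e : (sinh (alpha_max_rem beta eta omega EF k) / 2)^-1 =
      2 * (sinh (alpha_max_rem beta eta omega EF k))^-1 by rewrite invfM invrK mulrC.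
    rewrite e -mulrA ler_pM2l//.
    rewrite /alpha_max_rem; case: (leP (alpha_max_pole eta omega)) => _.
      apply: (@le_trans _ _ (c2 * Num.sqrt eta)^-1).
        by rewrite lef_pV2 ?posrE ?(lt_le_trans _ sr) ?mulr_gt0.
      rewrite invfM; apply: ler_wpM2l; first by rewrite invr_ge0 ltW.
      by rewrite -[leLHS]addr0 lerD2l ltW.
    apply: (@le_trans _ _ (k%:R / beta)^-1).
      by rewrite lef_pV2 ?posrE ?(lt_le_trans _ sk).
    rewrite bkE; apply: (@le_trans _ _ ((Num.sqrt eta)^-1 + beta / k%:R)).
      by rewrite lerDr invr_ge0 ltW.
    by rewrite ler_peMl ?invf_ge1// addr_ge0 ?invr_ge0 ?(ltW r0) ?(ltW bk0).
  apply: le_trans h; rewrite lef_pV2 ?posrE ?(divr_gt0 sh0)//.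
  by rewrite ler_pdivrMr// mulrC.
have si : (Num.sqrt eta)^-1 <= eta^-1.
  rewrite lef_pV2 ?posrE// -{1}rE expr2 ler_piMr ?(ltW r0)//.
  by rewrite -(ler_pXn2r (ltn0Sn 1)) ?nnegrE ?(ltW r0)// rE expr1n (le_trans (ltW e32)).
split=> //; apply: le_trans cK _; rewrite -/M -[leRHS]mulrA ler_pM2l// [leRHS]mulrACA.
apply: ler_pM => //; rewrite ?invr_ge0 ?(ltW a0)// ?addr_ge0 ?invr_ge0 ?(ltW a0) ?(ltW e0)//.
apply: (@le_trans _ _ (2 / c2 * (eta^-1 + beta / k%:R) + eta^-1)).
  rewrite lerD2r; apply: le_trans ai _.
  by rewrite ler_pM2l ?lerD2r// divr_gt0.
by rewrite [leRHS]mulrDl mul1r lerD2l -[leLHS]addr0 lerD2l ltW.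
Unshelve. all: by end_near. Qed.

End CardinalityBounds.

(** * Optimization of the cost *)

Section CostOptimization.
Context {R : realType}.
Implicit Types (u v x b kk c s : R).

(** With [u] for [eta^(-1/2)] this is the bound of [K_rem_card]; a single expression replaces the
    three regimes during the optimization. *)
Definition remainder_size (b kk u : R) : R := (u + b / kk) * (u ^+ 2 + b / kk).

Lemma remainder_size_gt0 b kk u : 0 < b -> 0 < kk -> 0 < u -> 0 < remainder_size b kk u.
Proof.
by move=> b0 k0 u0; rewrite mulr_gt0// addr_gt0// ?exprn_gt0// divr_gt0.
Qed.

Lemma remainder_size_le b kk u : 0 < b -> 0 < kk -> 1 <= u ->
  remainder_size b kk u <= u ^+ 3 + 2 * (u ^+ 2 * (b / kk)) + (b / kk) ^+ 2.
Proof.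
move=> b0 k0 u1; rewrite /remainder_size.
have x0 : 0 < b / kk by rewrite divr_gt0.
move: (b / kk) x0 => x x0.
have : u * x <= u ^+ 2 * x by rewrite ler_pM2r// expr2 ler_peMl//; lra.
lra.
Qed.

Lemma remainder_size_small b kk u C : 0 < b -> 0 < kk -> 1 <= u -> 0 < C ->
  b / kk <= C * u -> remainder_size b kk u <= (1 + C) ^+ 2 * u ^+ 3.
Proof.
move=> b0 k0 u1 C0 h; have x0 : 0 < b / kk by rewrite divr_gt0.
rewrite /remainder_size; move: (b / kk) x0 h => x x0 h.
rewrite (_ : _ * u ^+ 3 = ((1 + C) * u) * ((1 + C) * u ^+ 2)); last by ring.
have u2 : u <= u ^+ 2 by rewrite expr2 ler_peMl//; lra.
have h2 : C * u <= C * u ^+ 2 by rewrite ler_pM2l.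
by apply: ler_pM; [lra|rewrite addr_ge0 ?sqr_ge0// ltW|lra|lra].
Qed.

Lemma remainder_size_medium b kk u C C' : 0 < b -> 0 < kk -> 1 <= u ->
  0 < C -> 0 < C' -> b / kk <= C * u ^+ 2 -> u <= C' * (b / kk) ->
  remainder_size b kk u <= (1 + C') * (1 + C) * (b * u ^+ 2 / kk).
Proof.
move=> b0 k0 u1 C0 C'0; have x0 : 0 < b / kk by rewrite divr_gt0.
rewrite (_ : b * u ^+ 2 / kk = u ^+ 2 * (b / kk)); last by ring.
rewrite /remainder_size; move: (b / kk) x0 => x x0 h h'.
rewrite (_ : _ * (u ^+ 2 * x) = ((1 + C') * x) * ((1 + C) * u ^+ 2)); last by ring.
by apply: ler_pM; [lra|rewrite addr_ge0 ?sqr_ge0// ltW|lra|lra].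
Qed.

Lemma remainder_size_large b kk u C : 0 < b -> 0 < kk -> 1 <= u -> 0 < C ->
  u ^+ 2 <= C * (b / kk) ->
  remainder_size b kk u <= (1 + C) ^+ 2 * (b ^+ 2 / kk ^+ 2).
Proof.
move=> b0 k0 u1 C0; have x0 : 0 < b / kk by rewrite divr_gt0.
rewrite -expr_div_n /remainder_size; move: (b / kk) x0 => x x0 h.
have u2 : u <= u ^+ 2 by rewrite expr2 ler_peMl//; lra.
rewrite -exprMn expr2.
by apply: ler_pM; [lra|rewrite addr_ge0 ?sqr_ge0// ltW|lra|lra].
Qed.

(** In the product of the two summands [kk] cancels, so the bound is independent of k; [w] will be
    [beta^(1/2) eta^(-5/4)]. *)
Lemma amgm_bound b kk u w : 0 < b -> 0 < kk -> 0 < u -> 0 <= w ->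
  w ^+ 2 = u ^+ 5 * b -> w <= kk * u ^+ 3 + u ^+ 2 * (b / kk) / 4.
Proof.
move=> b0 k0 u0 w0 wE; have x0 : 0 < b / kk by rewrite divr_gt0.
have p0 : 0 <= kk * u ^+ 3 by rewrite mulr_ge0 ?exprn_ge0 ?ltW.
have q0 : 0 <= u ^+ 2 * (b / kk) / 4 by rewrite divr_ge0// mulr_ge0 ?exprn_ge0 ?ltW.
have pq : 4 * (kk * u ^+ 3 * (u ^+ 2 * (b / kk) / 4)) = w ^+ 2.
  by rewrite wE; field; exact: lt0r_neq0.
move: (kk * u ^+ 3) (u ^+ 2 * _ / 4) p0 q0 pq => p q p0 q0 pq.
by apply: ler_of_sqr; [lra|have := sqr_ge0 (p - q); lra].
Qed.

(** With [c] for [beta^(1/3)] and the rescaled [x = kk * u / c ^+ 2], this is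
    [x + x^-2 / 4 >= 1 / 4], again independent of k. *)
Lemma cubic_bound c kk u : 0 < c -> 0 < kk -> 0 < u ->
  c ^+ 2 * u ^+ 2 / 4 <= kk * u ^+ 3 + (c ^+ 3 / kk) ^+ 2 / 4.
Proof.
move=> c0 k0 u0; pose x := kk * u / c ^+ 2.
have x0 : 0 < x by rewrite divr_gt0 ?mulr_gt0 ?exprn_gt0.
have -> : kk * u ^+ 3 = c ^+ 2 * u ^+ 2 * x by rewrite /x; field; exact: lt0r_neq0.
have -> : (c ^+ 3 / kk) ^+ 2 = c ^+ 2 * u ^+ 2 * (x ^- 2).
  by rewrite /x; field; rewrite !lt0r_neq0.
have P0 : 0 < c ^+ 2 * u ^+ 2 by rewrite mulr_gt0 ?exprn_gt0.
rewrite -[X in _ <= _ + X]mulrA -mulrDr ler_pM2l//.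
have y0 : 0 < x^-1 by rewrite invr_gt0.
have xy : x * x^-1 = 1 by rewrite divff// lt0r_neq0.
rewrite -exprVn; move: (x^-1) y0 xy => y y0 xy.
have [h|h] := leP (1 / 4) x; first by have := sqr_ge0 y; lra.
have : 1 <= y by nra.
nra.
Qed.

Definition cost_size (b kk u : R) : R := kk * u ^+ 3 + remainder_size b kk u.

Lemma cost_size_case1 b kk u C C' : 0 < b -> 1 <= kk -> 1 <= u -> 0 < C -> 0 < C' ->
  kk <= C -> b <= C' * u -> cost_size b kk u <= (C + (1 + C') ^+ 2) * u ^+ 3.
Proof.
move=> b0 k1 u1 C0 C'0 hk hb.
have k0 : 0 < kk by lra.
have hx : b / kk <= C' * u.
  by rewrite ler_pdivrMr//; apply: le_trans hb _; rewrite ler_peMr// mulr_ge0; lra.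
have := remainder_size_small b0 k0 u1 C'0 hx; rewrite /cost_size mulrDl.
have : kk * u ^+ 3 <= C * u ^+ 3 by rewrite ler_pM2r// exprn_gt0//; lra.
lra.
Qed.

Lemma cost_size_case2 s v kk C C3 C4 : 0 < s -> 1 <= kk -> 1 <= v ->
  0 < C -> 0 < C3 -> 0 < C4 ->
  s ^+ 2 <= C * (v ^+ 2) ^+ 3 -> kk <= C3 * (s / v) -> s / v <= C4 * kk ->
  cost_size (s ^+ 2) kk (v ^+ 2) <=
    (2 * C3 + 2 * C4 + C4 ^+ 2 * (1 + C)) * (s * v ^+ 5).
Proof.
move=> s0 k1 v1 C0 C30 C40 hs hk hk'.
have k0 : 0 < kk by lra.
have v0 : 0 < v by lra.
have u1 : 1 <= v ^+ 2 by rewrite exprn_ege1.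
have b0 : 0 < s ^+ 2 by rewrite exprn_gt0.
apply: (@le_trans _ _ (kk * (v ^+ 2) ^+ 3 + ((v ^+ 2) ^+ 3 +
    2 * ((v ^+ 2) ^+ 2 * (s ^+ 2 / kk)) + (s ^+ 2 / kk) ^+ 2))).
  by rewrite lerD2l; exact: remainder_size_le.
have h1 : kk * (v ^+ 2) ^+ 3 <= C3 * (s * v ^+ 5).
  have -> : C3 * (s * v ^+ 5) = C3 * (s / v) * (v ^+ 2) ^+ 3.
    by field; exact: lt0r_neq0.
  by rewrite ler_pM2r// !exprn_gt0.
have h2 : (v ^+ 2) ^+ 3 <= kk * (v ^+ 2) ^+ 3.
  by rewrite ler_peMl// ltW// !exprn_gt0.
have h3 : s / kk <= C4 * v.
  rewrite ler_pdivrMr// mulrAC -ler_pdivrMr//.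
have h4 : (v ^+ 2) ^+ 2 * (s ^+ 2 / kk) <= C4 * (s * v ^+ 5).
  have -> : (v ^+ 2) ^+ 2 * (s ^+ 2 / kk) = s * v ^+ 4 * (s / kk) by ring.
  have -> : C4 * (s * v ^+ 5) = s * v ^+ 4 * (C4 * v) by ring.
  by rewrite ler_pM2l// mulr_gt0// exprn_gt0.
have h5 : s <= (1 + C) * v ^+ 3.
  apply: ler_of_sqr; first by rewrite mulr_ge0 ?exprn_ge0//; lra.
  apply: le_trans hs _.
  rewrite (_ : (_ * v ^+ 3) ^+ 2 = (1 + C) ^+ 2 * (v ^+ 2) ^+ 3); last by ring.
  apply: ler_wpM2r.
    by rewrite !exprn_ge0// ltW.
  nra.
have h6 : (s ^+ 2 / kk) ^+ 2 <= C4 ^+ 2 * (1 + C) * (s * v ^+ 5).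
  have -> : (s ^+ 2 / kk) ^+ 2 = (s / kk) ^+ 2 * s * s by field; exact: lt0r_neq0.
  have -> : C4 ^+ 2 * (1 + C) * (s * v ^+ 5) = (C4 * v) ^+ 2 * s * ((1 + C) * v ^+ 3) by ring.
  apply: ler_pM => //; [|exact: ltW|].
    by rewrite mulr_ge0 ?sqr_ge0// ltW.
  rewrite ler_pM2r// ler_pXn2r ?nnegrE//; first by rewrite divr_ge0// ltW.
  by rewrite mulr_ge0// ltW.
lra.
Qed.

(** Here [c] is [beta^(1/3)]. The choice [kk ~ c^2 / u] balances the pole cost against the quadratic
    remainder term, both of order [c^2 u^2]; the middle term is controlled by [u <~ c]. *)
Lemma cost_size_case3 c kk u C C3 C4 : 0 < c -> 1 <= kk -> 1 <= u ->
  0 < C -> 0 < C3 -> 0 < C4 ->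
  u ^+ 3 <= C * c ^+ 3 -> kk <= C3 * (c ^+ 2 / u) -> c ^+ 2 / u <= C4 * kk ->
  cost_size (c ^+ 3) kk u <=
    (2 * C3 + 2 * C4 * (1 + C) + C4 ^+ 2) * (c ^+ 2 * u ^+ 2).
Proof.
move=> c0 k1 u1 C0 C30 C40 hu hk hk'.
have k0 : 0 < kk by lra.
have u0 : 0 < u by lra.
have b0 : 0 < c ^+ 3 by rewrite exprn_gt0.
apply: (@le_trans _ _ (kk * u ^+ 3 + (u ^+ 3 +
    2 * (u ^+ 2 * (c ^+ 3 / kk)) + (c ^+ 3 / kk) ^+ 2))).
  by rewrite lerD2l; exact: remainder_size_le.
have h1 : kk * u ^+ 3 <= C3 * (c ^+ 2 * u ^+ 2).
  have -> : C3 * (c ^+ 2 * u ^+ 2) = C3 * (c ^+ 2 / u) * u ^+ 3.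
    by field; exact: lt0r_neq0.
  by rewrite ler_pM2r// exprn_gt0.
have h2 : u ^+ 3 <= kk * u ^+ 3 by rewrite ler_peMl// ltW// exprn_gt0.
have h3 : c ^+ 2 / kk <= C4 * u.
  by rewrite ler_pdivrMr// mulrAC -ler_pdivrMr.
have h4 : u <= (1 + C) * c.
  rewrite -(ler_pXn2r (ltn0Sn 2)) ?nnegrE ?(ltW u0) ?mulr_ge0 ?(ltW c0)//; last by lra.
  apply: le_trans hu _; rewrite exprMn ler_pM2r//.
  by rewrite (@le_trans _ _ ((1 + C) ^+ 1))//; [lra|rewrite ler_eXn2l//; lra].
have h5 : u ^+ 2 * (c ^+ 3 / kk) <= C4 * (1 + C) * (c ^+ 2 * u ^+ 2).
  have -> : u ^+ 2 * (c ^+ 3 / kk) = u ^+ 2 * c * (c ^+ 2 / kk) by field; exact: lt0r_neq0.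
  apply: (@le_trans _ _ (u ^+ 2 * c * (C4 * u))).
    by rewrite ler_pM2l// mulr_gt0// exprn_gt0.
  have -> : u ^+ 2 * c * (C4 * u) = C4 * u ^+ 2 * c * u by ring.
  have -> : C4 * (1 + C) * (c ^+ 2 * u ^+ 2) = C4 * u ^+ 2 * c * ((1 + C) * c) by ring.
  by rewrite ler_pM2l// !mulr_gt0// exprn_gt0.
have h6 : (c ^+ 3 / kk) ^+ 2 <= C4 ^+ 2 * (c ^+ 2 * u ^+ 2).
  have -> : (c ^+ 3 / kk) ^+ 2 = c ^+ 2 * (c ^+ 2 / kk) ^+ 2 by field; exact: lt0r_neq0.
  have -> : C4 ^+ 2 * (c ^+ 2 * u ^+ 2) = c ^+ 2 * (C4 * u) ^+ 2 by ring.
  rewrite ler_pM2l ?exprn_gt0// ler_pXn2r ?nnegrE//; first by rewrite divr_ge0 ?exprn_ge0// ltW.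
  by rewrite mulr_ge0// ltW.
lra.
Qed.

End CostOptimization.

(** * Fractional powers and Landau symbols *)

Section Asymptotics.
Context {R : realType}.
Implicit Types (beta eta : R) (k : nat).

Lemma powR_mulnr (x e : R) (n : nat) : 0 <= x -> x `^ (e * n%:R) = (x `^ e) ^+ n.
Proof. by move=> x0; rewrite powRrM powR_mulrn// powR_ge0. Qed.

(** Every exponent of eta that occurs is a multiple of 1/4; in this unit the powers become integral
    and polynomial arithmetic applies. *)
Definition fourth_root_inv eta : R := eta `^ (- (1 / 4)).

Lemma powR_fourth eta n (e : R) : 0 < eta -> e = - (1 / 4) * n%:R ->
  eta `^ e = fourth_root_inv eta ^+ n.
Proof. by move=> e0 ->; rewrite powR_mulnr ?ltW. Qed.

Lemma fourth_root_inv_ge1 eta : 0 < eta < 1 -> 1 <= fourth_root_inv eta.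
Proof.
move=> /andP[e0 e1]; rewrite /fourth_root_inv powRN invf_ge1 ?powR_gt0//.
rewrite -[leRHS](powRr0 eta).
by apply: ger_powR; [rewrite e0 ltW|rewrite divr_ge0].
Qed.

Lemma sqrt_fourth eta : 0 < eta -> (Num.sqrt eta)^-1 = fourth_root_inv eta ^+ 2.
Proof.
move=> e0; rewrite -powR12_sqrt ?ltW// -powRN; apply: powR_fourth => //; lra.
Qed.

Lemma inv_fourth eta : 0 < eta -> eta^-1 = fourth_root_inv eta ^+ 4.
Proof.
move=> e0; rewrite -powR_inv1 ?ltW//; apply: powR_fourth => //; lra.
Qed.

Lemma powR_half_fourth eta : 0 < eta -> eta `^ (1 / 2) = fourth_root_inv eta ^- 2.
Proof.
move=> e0; rewrite -(powR_fourth (e := - (1 / 2))) ?powRN ?invrK//; lra.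
Qed.

(** With x = beta / k and u = eta^(-1/2) the thresholds are x = u and x = u^2. The product expands
    to u^3 + x u + x u^2 + x^2; in the three regimes u^3, x u^2 and x^2 dominate the other three
    terms, hence the factor 4. *)
Lemma cost_bound_size beta eta k : 0 < beta -> 0 < eta < 1 -> (0 < k)%N ->
  cost_bound beta eta k <= cost_size beta k%:R (fourth_root_inv eta ^+ 2) /\
  cost_size beta k%:R (fourth_root_inv eta ^+ 2) <= 4 * cost_bound beta eta k.
Proof.
move=> b0 e01; have /andP[e0 e1] := e01; rewrite -(ltr0n R) => k0.
have := fourth_root_inv_ge1 e01.
rewrite /cost_bound /remainder_bound /cost_size (inv_fourth e0) (powR_half_fourth e0).
rewrite (@powR_fourth eta 6 (- (3 / 2)) e0); last by lra.
have -> : beta * eta = beta * (fourth_root_inv eta ^+ 4)^-1.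
  by rewrite -(inv_fourth e0) invrK.
move: (fourth_root_inv eta) => v v1; set kk : R := k%:R in k0 *.
have v0 : 0 < v by lra.
have u1 : 1 <= v ^+ 2 by rewrite exprn_ege1.
have u0 : 0 < v ^+ 2 by rewrite exprn_gt0.
rewrite (_ : v ^+ 6 = (v ^+ 2) ^+ 3); last by ring.
rewrite (_ : v ^+ 4 = (v ^+ 2) ^+ 2); last by ring.
move: (v ^+ 2) u0 u1 => u u0 u1.
have u20 : 0 < u ^+ 2 by rewrite exprn_gt0.
have uu : u <= u ^+ 2 by rewrite expr2 ler_peMl// ltW.
have x0 : 0 < beta / kk by rewrite divr_gt0.
rewrite /remainder_size -expr_div_n mulrAC.
rewrite ler_pdivrMr// ler_pdivrMr// -(ler_pdivrMl _ _ k0) -(ler_pdivrMl _ _ k0).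
rewrite [kk^-1 * beta]mulrC; move: (beta / kk) x0 => x x0.
have p0 : 0 <= kk * u ^+ 3 by rewrite mulr_ge0 ?exprn_ge0 ?ltW.
have e3 : u * u ^+ 2 = u ^+ 3 by ring.
have xu : 0 < x * u by rewrite mulr_gt0.
have xu2 : 0 < x * u ^+ 2 by rewrite mulr_gt0.
have x20 : 0 < x ^+ 2 by rewrite exprn_gt0.
have -> : (u + x) * (u ^+ 2 + x) = u ^+ 3 + x * u + x * u ^+ 2 + x ^+ 2 by ring.
have u30 : 0 < u ^+ 3 by rewrite exprn_gt0.
have xuu : x * u <= x * u ^+ 2 by rewrite ler_pM2l.
have [h1|h1] := leP x u.
  have h2 : x * u ^+ 2 <= u ^+ 3 by rewrite -e3 ler_pM2r.
  have h3 : x ^+ 2 <= x * u by rewrite expr2 ler_pM2l.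
  by split; lra.
have [h2|h2] := leP x (u ^+ 2).
  have h3 : u ^+ 3 <= x * u ^+ 2 by rewrite -e3 ler_pM2r// ltW.
  have h4 : x ^+ 2 <= x * u ^+ 2 by rewrite expr2 ler_pM2l.
  by split; lra.
have h3 : x * u ^+ 2 <= x ^+ 2 by rewrite expr2 ler_pM2l// ltW.
have h4 : u ^+ 3 <= x * u ^+ 2 by rewrite -e3 ler_pM2r// ltW.
by split; lra.
Qed.

Lemma lesssim_eqO (I : Type) (F : filter_on I) (f g : I -> R) :
  (\forall i \near F, 0 <= f i) -> (\forall i \near F, 0 <= g i) ->
  lesssim F f g -> f =O_F g.
Proof.
move=> f0 g0 [c c0 fg]; apply/eqO_exP; exists c => //.
near=> i; rewrite !ger0_norm//; near: i => //.
Unshelve. all: by end_near. Qed.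

Lemma Theta_lesssim (I : Type) (F : filter_on I) (f g : I -> R) :
  (\forall i \near F, 0 <= f i) -> (\forall i \near F, 0 <= g i) ->
  f =Theta_F g -> lesssim F f g /\ lesssim F g f.
Proof.
move=> f0 g0; rewrite eqThetaE bigThetaE eqOmegaO.
have eqO (a b : I -> R) : (\forall i \near F, 0 <= a i) ->
    (\forall i \near F, 0 <= b i) -> a =O_F b -> lesssim F a b.
  move=> a0 b0 /eqO_exP[c c0 ab]; exists c => //.
  near=> i; have := near ab i; rewrite !ger0_norm; first by apply.
    by near: i.
  by near: i.
by move=> [fg gf]; split; exact: eqO.
Unshelve. all: by end_near. Qed.

End Asymptotics.

(** * The theorem *)

Lemma sum_poles_const {R : realType} (beta EF : R) (k n : nat) :
  (\sum_(z <- poles beta EF k) n = 2 * k * n)%N.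
Proof.
by rewrite big_const_seq count_predT size_map size_iota iter_addn addn0 mulnC.
Qed.

Lemma total_matvec_bound_le {R : realType} (tau beta eta omega EF : R) (k : nat) :
  finite_set (K_rem tau beta eta omega EF k) -> finite_set (K_pole tau eta omega) ->
  (total_matvec_bound tau beta eta omega EF k <=
   2 * total_inner_products tau beta eta omega EF k)%N.
Proof.
move=> fr fp; rewrite /total_matvec_bound /total_inner_products !sum_poles_const.
by rewrite mulnDr leq_add ?matvec_bound_le// mulnCA leq_mul// matvec_bound_le.
Qed.

Lemma total_solve_cost_le {R : realType} (solve : Cplx R -> R) (beta EF m : R) (k : nat) :
  (forall z, z \in poles beta EF k -> solve z <= m) ->
  total_solve_cost solve beta EF k <= (2 * k)%:R * (2 * m).
Proof.
move=> hm; rewrite /total_solve_cost big_seq.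
apply: (@le_trans _ _ (\sum_(z <- poles beta EF k | z \in poles beta EF k) (2 * m))).
  by apply: ler_sum => z /hm; rewrite ler_pM2l.
rewrite -big_seq big_const_seq count_predT size_map size_iota iter_addr addr0.
by rewrite (mulr_natl (2 * m) (2 * k)) lexx.
Qed.

(** * Transfer to the actual inner-product counts *)

Section CostAnalysis.
Context {R : realType} {I : Type} (F : filter_on I).
Context (tau : R) (beta eta omega EF : I -> R) (k : I -> nat).
Context (tau_gt0 : 0 < tau) (tau_lt1 : tau < 1).
Context (beta_lim : beta @ F --> +oo) (eta_lim : eta @ F --> 0^'+).
Context (omega_eta : lesssim F (fun i => `|omega i|) eta).
Context (k_ge1 : forall i, (1 <= k i)%N).

Let v i : R := fourth_root_inv (eta i).
Let kr i : R := (k i)%:R.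
Let nrem i : R := (card_set (K_rem tau (beta i) (eta i) (omega i) (EF i) (k i)))%:R.
Let npole i : R := (card_set (K_pole tau (eta i) (omega i)))%:R.
Let IP i : R :=
  (total_inner_products tau (beta i) (eta i) (omega i) (EF i) (k i))%:R.

Lemma near_eta (P : R -> Prop) : (\forall e \near 0^'+, P e) ->
  \forall i \near F, P (eta i).
Proof. exact: eta_lim. Qed.

Lemma near_params : \forall i \near F, 0 < beta i /\ 0 < eta i < 1.
Proof.
have hb : \forall i \near F, 0 < beta i by exact: cvgry_gt.
have he : \forall i \near F, 0 < eta i by exact: near_eta (nbhs_right_gt _).
have he1 : \forall i \near F, eta i < 1 by exact: near_eta (nbhs_right_lt ltr01).
by near=> i; split; [near: i|apply/andP; split; near: i].
Unshelve. all: by end_near. Qed.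

Lemma total_inner_productsE i : IP i = 2 * kr i * npole i + nrem i.
Proof.
by rewrite /IP /total_inner_products sum_poles_const natrD !natrM addrC.
Qed.

Lemma near_pole : exists A B : R, [/\ 0 < A, 0 < B & \forall i \near F,
  [/\ finite_set (K_pole tau (eta i) (omega i)),
      A * v i ^+ 6 <= npole i & npole i <= B * v i ^+ 6]].
Proof.
have tau01 : 0 < tau < 1 by rewrite tau_gt0.
have [c c0 hw] := omega_eta; have [A [B [A0 B0 /near_eta H]]] := K_pole_card tau01 c0.
exists A, B; split=> //.
move: near_params H hw; apply: filterS3 => i [_ /andP[e0 _]] Hi /Hi.
have -> // : (eta i * Num.sqrt (eta i))^-1 = v i ^+ 6.
by rewrite invfM (inv_fourth e0) (sqrt_fourth e0) -exprD.
Qed.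

Lemma near_rem : exists2 B : R, 0 < B & \forall i \near F,
  finite_set (K_rem tau (beta i) (eta i) (omega i) (EF i) (k i)) /\
  nrem i <= B * remainder_size (beta i) (kr i) (v i ^+ 2).
Proof.
have tau01 : 0 < tau < 1 by rewrite tau_gt0.
have [c c0 hw] := omega_eta; have [B B0 /near_eta H] := K_rem_card tau01 c0.
exists B => //.
move: near_params H hw; apply: filterS3 => i [b0 /andP[e0 _]] Hi hi.
have := Hi _ _ (EF i) _ hi b0 (k_ge1 i).
by rewrite (inv_fourth e0) (sqrt_fourth e0) /remainder_size -exprM.
Qed.

Lemma near_size : \forall i \near F,
  [/\ 1 <= v i, 0 < kr i, 1 <= kr i, 1 <= v i ^+ 2 & 0 < v i].
Proof.
near=> i.
have [_ e0] : 0 < beta i /\ 0 < eta i < 1 by near: i; exact: near_params.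
have v1 := fourth_root_inv_ge1 e0.
split=> //; rewrite ?ltr0n ?ler1n ?k_ge1 ?exprn_ege1//.
exact: lt_le_trans v1.
Unshelve. all: by end_near. Qed.

Lemma nrem_ge0 i : 0 <= nrem i. Proof. by rewrite ler0n. Qed.

(** Each projection of an index set is no larger than the set, which gives the constant 2 for the
    products. The [4 * k] solves are paid for by the pole terms, by the lower bound [A] on their
    size. *)
Lemma other_costs_eqO (matvecs : I -> nat) (solve : I -> Cplx R -> R) :
  (forall i, (matvecs i <=
     total_matvec_bound tau (beta i) (eta i) (omega i) (EF i) (k i))%N) ->
  (forall i z, 0 <= solve i z) ->
  (exists2 c : R, 0 < c & \forall i \near F,
     forall z, z \in poles (beta i) (EF i) (k i) ->
       solve i z <= c * eta i `^ (- (3 / 2))) ->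
  (fun i => (matvecs i)%:R + total_solve_cost (solve i) (beta i) (EF i) (k i))
    =O_F IP.
Proof.
move=> hm hs [c c0 hsolve]; have [A [B [A0 B0 hp]]] := near_pole.
have [B' B'0 hr] := near_rem.
apply: lesssim_eqO.
- apply: nearW => i; apply: addr_ge0; rewrite ?ler0n// sumr_ge0// => z _.
  by rewrite mulr_ge0.
- by apply: nearW => i; rewrite ler0n.
exists (2 + 2 * c / A); first by rewrite addr_gt0// divr_gt0// mulr_gt0.
near=> i.
have [b0 /andP[e0 e1]] : 0 < beta i /\ 0 < eta i < 1 by near: i; exact: near_params.
have hsi : forall z, z \in poles (beta i) (EF i) (k i) ->
    solve i z <= c * eta i `^ (- (3 / 2)) by near: i.
have [fp hA _] : [/\ finite_set (K_pole tau (eta i) (omega i)),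
  A * v i ^+ 6 <= npole i & npole i <= B * v i ^+ 6] by near: i.
have [fr _] : finite_set (K_rem tau (beta i) (eta i) (omega i) (EF i) (k i)) /\
  nrem i <= B' * remainder_size (beta i) (kr i) (v i ^+ 2) by near: i.
rewrite mulrDl; apply: lerD.
  rewrite -(natrM _ 2) ler_nat; apply: leq_trans (hm i) _.
  exact: total_matvec_bound_le.
apply: le_trans (total_solve_cost_le hsi) _.
rewrite (@powR_fourth _ (eta i) 6 (- (3 / 2)) e0) -/(v i); last by lra.
apply: (@le_trans _ _ (2 * c / A * (2 * kr i * npole i))).
  rewrite (_ : _ * (2 * (c * _)) = 2 * c / A * (2 * kr i * (A * v i ^+ 6))); last first.
    by rewrite natrM /kr; field; exact: lt0r_neq0.
  apply: ler_wpM2l; first by rewrite divr_ge0 ?mulr_ge0// ltW.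
  by apply: ler_wpM2l => //; rewrite mulr_ge0// ler0n.
apply: ler_wpM2l; first by rewrite divr_ge0 ?mulr_ge0// ltW.
by rewrite total_inner_productsE lerDl nrem_ge0.
Unshelve. all: by end_near. Qed.

Lemma npole_eqO :
  (fun i => 2 * kr i * npole i) =O_F (fun i => kr i * eta i `^ (- (3 / 2))).
Proof.
have [A [B [A0 B0 hp]]] := near_pole.
apply: lesssim_eqO.
- by apply: nearW => i; rewrite !mulr_ge0// ler0n.
- by apply: nearW => i; rewrite mulr_ge0 ?powR_ge0// ler0n.
exists (2 * B); first by rewrite mulr_gt0.
move: near_params hp; apply: filterS2 => i [_ /andP[e0 _]] [_ _ h].
rewrite (@powR_fourth _ (eta i) 6 (- (3 / 2)) e0) -/(v i); last by lra.
rewrite (_ : 2 * B * _ = 2 * kr i * (B * v i ^+ 6)); last by ring.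
by apply: ler_wpM2l => //; rewrite mulr_ge0// ler0n.
Qed.

Lemma nrem_lesssim (X : I -> R) : (\forall i \near F, 0 <= X i) ->
  lesssim F (fun i => remainder_size (beta i) (kr i) (v i ^+ 2)) X ->
  nrem =O_F X.
Proof.
move=> X0 [C C0 hX]; have [B B0 hr] := near_rem.
apply: lesssim_eqO => //; first by apply: nearW => i; exact: nrem_ge0.
exists (B * C); first by rewrite mulr_gt0.
move: hX hr; apply: filterS2 => i hX [_ hr].
by apply: le_trans hr _; rewrite -mulrA ler_pM2l.
Qed.

Lemma nrem_small :
  lesssim F (fun i => beta i * eta i `^ (1 / 2)) kr ->
  nrem =O_F (fun i => eta i `^ (- (3 / 2))).
Proof.
move=> [C C0 h]; apply: nrem_lesssim; first by apply: nearW => i; exact: powR_ge0.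
exists ((1 + C) ^+ 2); first by rewrite exprn_gt0// addr_gt0.
move: near_params near_size h; apply: filterS3 => i [b0 /andP[e0 _]] [v1 k0 k1 u1 v0].
rewrite (@powR_fourth _ (eta i) 6 (- (3 / 2)) e0) -/(v i); last by lra.
rewrite (powR_half_fourth e0) -/(v i) (_ : v i ^+ 6 = (v i ^+ 2) ^+ 3); last by ring.
rewrite ler_pdivrMr ?exprn_gt0// => h; apply: remainder_size_small => //.
by rewrite ler_pdivrMr// mulrAC.
Qed.

Lemma nrem_medium :
  lesssim F (fun i => beta i * eta i) kr ->
  lesssim F kr (fun i => beta i * eta i `^ (1 / 2)) ->
  nrem =O_F (fun i => beta i * (eta i)^-1 / kr i).
Proof.
move=> [C C0 h] [C' C'0 h']; apply: nrem_lesssim.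
  move: near_params near_size; apply: filterS2 => i [b0 /andP[e0 _]] [v1 k0 k1 u1 v0].
  by rewrite divr_ge0 ?mulr_ge0 ?invr_ge0 ?ltW.
exists ((1 + C') * (1 + C)); first by rewrite mulr_gt0 ?addr_gt0.
near=> i.
have [b0 /andP[e0 _]] : 0 < beta i /\ 0 < eta i < 1 by near: i; exact: near_params.
have [v1 k0 k1 u1 v0] : [/\ 1 <= v i, 0 < kr i, 1 <= kr i, 1 <= v i ^+ 2 & 0 < v i].
  by near: i; exact: near_size.
have hi : beta i * eta i <= C * kr i by near: i.
have hi' : kr i <= C' * (beta i * eta i `^ (1 / 2)) by near: i.
rewrite (powR_half_fourth e0) -/(v i) mulrA ler_pdivlMr ?exprn_gt0// in hi'.
rewrite -[eta i]invrK (inv_fourth e0) -/(v i) ler_pdivrMr ?exprn_gt0// in hi.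
rewrite (inv_fourth e0) -/(v i) (_ : v i ^+ 4 = (v i ^+ 2) ^+ 2); last by ring.
apply: remainder_size_medium => //.
  rewrite ler_pdivrMr// mulrAC; apply: le_trans hi _.
  by rewrite le_eqVlt; apply/orP; left; apply/eqP; ring.
by rewrite mulrA ler_pdivlMr// mulrC.
Unshelve. all: by end_near. Qed.

Lemma nrem_large :
  lesssim F kr (fun i => beta i * eta i) ->
  nrem =O_F (fun i => beta i ^+ 2 / kr i ^+ 2).
Proof.
move=> [C C0 h]; apply: nrem_lesssim.
  by apply: nearW => i; rewrite divr_ge0// sqr_ge0.
exists ((1 + C) ^+ 2); first by rewrite exprn_gt0// addr_gt0.
move: near_params near_size h; apply: filterS3 => i [b0 /andP[e0 _]] [v1 k0 k1 u1 v0].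
rewrite -[eta i]invrK (inv_fourth e0) -/(v i) mulrA ler_pdivlMr ?exprn_gt0// => h.
apply: remainder_size_large => //.
by rewrite mulrA ler_pdivlMr// -exprM mulrC.
Qed.

(** [X] bounds the cost at the chosen k from above and the cost at every competitor from below; this
    yields optimality and the bound on the inner products together. *)
Lemma cost_optimum (X : I -> R) : (\forall i \near F, 0 <= X i) ->
  lesssim F (fun i => cost_size (beta i) (kr i) (v i ^+ 2)) X ->
  (forall k' : I -> nat, (forall i, (1 <= k' i)%N) ->
     \forall i \near F, X i <= 4 * cost_size (beta i) (k' i)%:R (v i ^+ 2)) ->
  (forall k' : I -> nat, (forall i, (1 <= k' i)%N) ->
     (fun i => cost_bound (beta i) (eta i) (k i)) =O_F
     (fun i => cost_bound (beta i) (eta i) (k' i))) /\ IP =O_F X.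
Proof.
move=> X0 [C C0 hX] lbX.
have cost_ge0 (k' : I -> nat) : (forall i, (1 <= k' i)%N) ->
    \forall i \near F, 0 <= cost_bound (beta i) (eta i) (k' i).
  move=> k'1; move: near_params near_size; apply: filterS2 => i [b0 e01] [_ _ _ u1 _].
  have := (cost_bound_size b0 e01 (k'1 i)).2; rewrite -/(v i).
  have : 0 <= cost_size (beta i) (k' i)%:R (v i ^+ 2).
    have u0 : 0 < v i ^+ 2 by lra.
    have k'0 : 0 < (k' i)%:R :> R by rewrite ltr0n.
    apply: addr_ge0; last exact/ltW/remainder_size_gt0.
    by apply: mulr_ge0; [exact: ltW|exact/exprn_ge0/ltW].
  lra.
split=> [k' k'1|].
  apply: lesssim_eqO; [exact: cost_ge0|exact: cost_ge0|].
  (* One factor 4 comes from the lower bound on the competitor, the other from [cost_bound_size]. *)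
  exists (C * 16); first by rewrite mulr_gt0.
  move: near_params hX (lbX k' k'1); apply: filterS3 => i [b0 e01] h1 h2.
  have := (cost_bound_size b0 e01 (k_ge1 i)).1.
  have := (cost_bound_size b0 e01 (k'1 i)).2; rewrite -/(v i) => h3 h4.
  have h5 : C * X i <= C * (16 * cost_bound (beta i) (eta i) (k' i)).
    by rewrite ler_pM2l//; lra.
  by apply: le_trans h4 _; apply: le_trans h1 _; rewrite -mulrA.
have [A [B [A0 B0 hp]]] := near_pole; have [B' B'0 hr] := near_rem.
apply: lesssim_eqO => //; first by apply: nearW => i; rewrite ler0n.
exists ((2 * B + B') * C); first by rewrite mulr_gt0// addr_gt0// mulr_gt0.
near=> i.
have [b0 e01] : 0 < beta i /\ 0 < eta i < 1 by near: i; exact: near_params.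
have [v1 k0 k1 u1 v0] : [/\ 1 <= v i, 0 < kr i, 1 <= kr i, 1 <= v i ^+ 2 & 0 < v i].
  by near: i; exact: near_size.
have [_ _ h1] : [/\ finite_set (K_pole tau (eta i) (omega i)),
  A * v i ^+ 6 <= npole i & npole i <= B * v i ^+ 6] by near: i.
have [_ h2] : finite_set (K_rem tau (beta i) (eta i) (omega i) (EF i) (k i)) /\
  nrem i <= B' * remainder_size (beta i) (kr i) (v i ^+ 2) by near: i.
have hXi : cost_size (beta i) (kr i) (v i ^+ 2) <= C * X i by near: i.
rewrite total_inner_productsE -[leRHS]mulrA.
apply: (@le_trans _ _ ((2 * B + B') * cost_size (beta i) (kr i) (v i ^+ 2))); last first.
  by rewrite ler_pM2l// addr_gt0// mulr_gt0.
have u0 : 0 < v i ^+ 2 by rewrite exprn_gt0.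
have p0 : 0 <= kr i * (v i ^+ 2) ^+ 3 by rewrite mulr_ge0 ?exprn_ge0// ltW.
have q0 := ltW (remainder_size_gt0 b0 k0 u0).
have h3 : 2 * kr i * npole i <= 2 * B * (kr i * (v i ^+ 2) ^+ 3).
  rewrite (_ : 2 * B * _ = 2 * kr i * (B * v i ^+ 6)); last by ring.
  by rewrite ler_pM2l// mulr_gt0.
have h4 : 0 <= B' * (kr i * (v i ^+ 2) ^+ 3) by rewrite mulr_ge0// ltW.
have h5 : 0 <= 2 * B * remainder_size (beta i) (kr i) (v i ^+ 2).
  by rewrite mulr_ge0// mulr_ge0// ltW.
by rewrite /cost_size mulrDr !mulrDl; lra.
Unshelve. all: by end_near. Qed.

End CostAnalysis.

(** * The three choices of k and the matching lower bounds *)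

Section CostCases.
Context {R : realType} {I : Type} (F : filter_on I).
Context (beta eta : I -> R) (k : I -> nat).
Context (beta_lim : beta @ F --> +oo) (eta_lim : eta @ F --> 0^'+).
Context (k_ge1 : forall i, (1 <= k i)%N).

Let v i : R := fourth_root_inv (eta i).
Let kr i : R := (k i)%:R.
Let size i : R := cost_size (beta i) (kr i) (v i ^+ 2).

Lemma near_kr_ge0 : \forall i \near F, 0 <= kr i.
Proof. by apply: nearW => i; rewrite ler0n. Qed.

Lemma cost_case1 : lesssim F beta (fun i => eta i `^ (- (1 / 2))) ->
  kr =Theta_F (fun=> 1 : R) ->
  lesssim F size (fun i => eta i `^ (- (3 / 2))).
Proof.
move=> [C C0 hb]; have one0 : \forall i \near F, (0 : R) <= 1 by apply: nearW.
move=> /(Theta_lesssim near_kr_ge0 one0)[[C' C'0 hk] _].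
exists (C' + (1 + C) ^+ 2); first by rewrite addr_gt0 ?exprn_gt0 ?addr_gt0.
near=> i.
have [b0 /andP[e0 _]] : 0 < beta i /\ 0 < eta i < 1.
  by near: i; exact: near_params.
have [v1 k0 k1 u1 v0] : [/\ 1 <= v i, 0 < kr i, 1 <= kr i, 1 <= v i ^+ 2 & 0 < v i].
  by near: i; exact: near_size beta_lim eta_lim k_ge1.
have hbi : beta i <= C * eta i `^ (- (1 / 2)) by near: i.
have hki : kr i <= C' * 1 by near: i.
rewrite (@powR_fourth _ (eta i) 6 (- (3 / 2)) e0) -/(v i); last by lra.
rewrite (@powR_fourth _ (eta i) 2 (- (1 / 2)) e0) -/(v i) in hbi; last by lra.
rewrite (_ : v i ^+ 6 = (v i ^+ 2) ^+ 3); last by ring.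
by apply: cost_size_case1 => //; rewrite mulr1 in hki.
Unshelve. all: by end_near. Qed.

Lemma cost_case2 : lesssim F beta (fun i => eta i `^ (- (3 / 2))) ->
  kr =Theta_F (fun i => beta i `^ (1 / 2) * eta i `^ (1 / 4)) ->
  lesssim F size (fun i => beta i `^ (1 / 2) * eta i `^ (- (5 / 4))).
Proof.
move=> [C C0 hb].
have g0 : \forall i \near F, 0 <= beta i `^ (1 / 2) * eta i `^ (1 / 4).
  by apply: nearW => i; rewrite mulr_ge0 ?powR_ge0.
move=> /(Theta_lesssim near_kr_ge0 g0)[[C3 C30 hk] [C4 C40 hk']].
exists (2 * C3 + 2 * C4 + C4 ^+ 2 * (1 + C)).
  by rewrite !addr_gt0 ?mulr_gt0 ?exprn_gt0 ?addr_gt0.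
near=> i.
have [b0 /andP[e0 _]] : 0 < beta i /\ 0 < eta i < 1.
  by near: i; exact: near_params.
have [v1 k0 k1 u1 v0] : [/\ 1 <= v i, 0 < kr i, 1 <= kr i, 1 <= v i ^+ 2 & 0 < v i].
  by near: i; exact: near_size beta_lim eta_lim k_ge1.
have hbi : beta i <= C * eta i `^ (- (3 / 2)) by near: i.
have hki : kr i <= C3 * (beta i `^ (1 / 2) * eta i `^ (1 / 4)) by near: i.
have hki' : beta i `^ (1 / 2) * eta i `^ (1 / 4) <= C4 * kr i by near: i.
have e4 : eta i `^ (1 / 4) = (v i)^-1 by rewrite /v /fourth_root_inv powRN invrK.
rewrite e4 in hki hki'.
rewrite (@powR_fourth _ (eta i) 5 (- (5 / 4)) e0) -/(v i); last by lra.
rewrite (@powR_fourth _ (eta i) 6 (- (3 / 2)) e0) -/(v i) in hbi; last by lra.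
rewrite (_ : v i ^+ 6 = (v i ^+ 2) ^+ 3) in hbi; last by ring.
have sE : beta i = (beta i `^ (1 / 2)) ^+ 2.
  by rewrite -powR_mulnr ?ltW// divfK// powRr1 ?ltW.
have s0 : 0 < beta i `^ (1 / 2) by exact: powR_gt0.
rewrite /size {1}sE; rewrite {1}sE in hbi.
exact: cost_size_case2.
Unshelve. all: by end_near. Qed.

Lemma cost_case3 : lesssim F (fun i => eta i `^ (- (3 / 2))) beta ->
  kr =Theta_F (fun i => beta i `^ (2 / 3) * eta i `^ (1 / 2)) ->
  lesssim F size (fun i => beta i `^ (2 / 3) * (eta i)^-1).
Proof.
move=> [C C0 hb].
have g0 : \forall i \near F, 0 <= beta i `^ (2 / 3) * eta i `^ (1 / 2).
  by apply: nearW => i; rewrite mulr_ge0 ?powR_ge0.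
move=> /(Theta_lesssim near_kr_ge0 g0)[[C3 C30 hk] [C4 C40 hk']].
exists (2 * C3 + 2 * C4 * (1 + C) + C4 ^+ 2).
  by rewrite !addr_gt0 ?mulr_gt0 ?exprn_gt0 ?addr_gt0.
near=> i.
have [b0 /andP[e0 _]] : 0 < beta i /\ 0 < eta i < 1.
  by near: i; exact: near_params.
have [v1 k0 k1 u1 v0] : [/\ 1 <= v i, 0 < kr i, 1 <= kr i, 1 <= v i ^+ 2 & 0 < v i].
  by near: i; exact: near_size beta_lim eta_lim k_ge1.
have hbi : eta i `^ (- (3 / 2)) <= C * beta i by near: i.
have hki : kr i <= C3 * (beta i `^ (2 / 3) * eta i `^ (1 / 2)) by near: i.
have hki' : beta i `^ (2 / 3) * eta i `^ (1 / 2) <= C4 * kr i by near: i.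
have cE : beta i = (beta i `^ (1 / 3)) ^+ 3.
  by rewrite -powR_mulnr ?ltW// divfK// powRr1 ?ltW.
have c2E : beta i `^ (2 / 3) = (beta i `^ (1 / 3)) ^+ 2.
  by rewrite -powR_mulnr ?ltW//; congr (_ `^ _); lra.
rewrite (powR_half_fourth e0) c2E -/(v i) in hki hki'.
rewrite (inv_fourth e0) c2E -/(v i) (_ : v i ^+ 4 = (v i ^+ 2) ^+ 2); last by ring.
rewrite (@powR_fourth _ (eta i) 6 (- (3 / 2)) e0) -/(v i) in hbi; last by lra.
rewrite (_ : v i ^+ 6 = (v i ^+ 2) ^+ 3) in hbi; last by ring.
have c0 : 0 < beta i `^ (1 / 3) by exact: powR_gt0.
rewrite /size {1}cE; rewrite {1}cE in hbi.
exact: cost_size_case3.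
Unshelve. all: by end_near. Qed.

(** The pole cost alone gives this, because k is at least 1. The three lower bounds hold for an
    arbitrary k, so they apply to every competitor. *)
Lemma cost_lower1 : \forall i \near F,
  eta i `^ (- (3 / 2)) <= 4 * size i.
Proof.
move: (near_params beta_lim eta_lim) (near_size beta_lim eta_lim k_ge1).
apply: filterS2 => i [b0 /andP[e0 _]] [v1 k0 k1 u1 v0].
rewrite (@powR_fourth _ (eta i) 6 (- (3 / 2)) e0) -/(v i); last by lra.
rewrite (_ : v i ^+ 6 = (v i ^+ 2) ^+ 3); last by ring.
have u0 : 0 < v i ^+ 2 by rewrite exprn_gt0.
have := remainder_size_gt0 b0 k0 u0; rewrite /size /cost_size.
have : (v i ^+ 2) ^+ 3 <= kr i * (v i ^+ 2) ^+ 3 by rewrite ler_peMl// !exprn_ge0// ltW.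
have : 0 < (v i ^+ 2) ^+ 3 by rewrite exprn_gt0.
lra.
Qed.

Lemma cost_lower2 : \forall i \near F,
  beta i `^ (1 / 2) * eta i `^ (- (5 / 4)) <= 4 * size i.
Proof.
move: (near_params beta_lim eta_lim) (near_size beta_lim eta_lim k_ge1).
apply: filterS2 => i [b0 /andP[e0 _]] [v1 k0 k1 u1 v0].
rewrite (@powR_fourth _ (eta i) 5 (- (5 / 4)) e0) -/(v i); last by lra.
have u0 : 0 < v i ^+ 2 by rewrite exprn_gt0.
have s0 : 0 < beta i `^ (1 / 2) by exact: powR_gt0.
have sE : (beta i `^ (1 / 2)) ^+ 2 = beta i.
  by rewrite -powR_mulnr ?ltW// divfK// powRr1 ?ltW.
have w0 : 0 <= beta i `^ (1 / 2) * v i ^+ 5 by rewrite mulr_ge0 ?exprn_ge0 ?(ltW s0) ?(ltW v0).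
have wE : (beta i `^ (1 / 2) * v i ^+ 5) ^+ 2 = (v i ^+ 2) ^+ 5 * beta i.
  by rewrite exprMn sE; ring.
have := amgm_bound b0 k0 u0 w0 wE; rewrite /size /cost_size /remainder_size.
have x0 : 0 < beta i / kr i by rewrite divr_gt0.
have p0 : 0 < kr i * (v i ^+ 2) ^+ 3 by rewrite mulr_gt0 ?exprn_gt0.
move: (beta i / kr i) (v i ^+ 2) u0 x0 p0 => x u u0 x0 p0.
have : 0 < u * u ^+ 2 by rewrite mulr_gt0 ?exprn_gt0.
have : 0 < u * x by rewrite mulr_gt0.
have : 0 < x * x by rewrite mulr_gt0.
have : 0 < u ^+ 2 * x by rewrite mulr_gt0 ?exprn_gt0.
lra.
Qed.

Lemma cost_lower3 : \forall i \near F,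
  beta i `^ (2 / 3) * (eta i)^-1 <= 4 * size i.
Proof.
move: (near_params beta_lim eta_lim) (near_size beta_lim eta_lim k_ge1).
apply: filterS2 => i [b0 /andP[e0 _]] [v1 k0 k1 u1 v0].
have c0 : 0 < beta i `^ (1 / 3) by exact: powR_gt0.
have u0 : 0 < v i ^+ 2 by rewrite exprn_gt0.
have cE : (beta i `^ (1 / 3)) ^+ 3 = beta i.
  by rewrite -powR_mulnr ?ltW// divfK// powRr1 ?ltW.
have c2E : beta i `^ (2 / 3) = (beta i `^ (1 / 3)) ^+ 2.
  by rewrite -powR_mulnr ?ltW//; congr (_ `^ _); lra.
rewrite (inv_fourth e0) c2E -/(v i) (_ : v i ^+ 4 = (v i ^+ 2) ^+ 2); last by ring.
have := cubic_bound c0 k0 u0; rewrite cE /size /cost_size /remainder_size.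
have x0 : 0 < beta i / kr i by rewrite divr_gt0.
have p0 : 0 < kr i * (v i ^+ 2) ^+ 3 by rewrite mulr_gt0 ?exprn_gt0.
move: (beta i / kr i) (v i ^+ 2) u0 x0 p0 => x u u0 x0 p0.
have : 0 < u * u ^+ 2 by rewrite mulr_gt0 ?exprn_gt0.
have : 0 < u * x by rewrite mulr_gt0.
have : 0 < x * x by rewrite mulr_gt0.
have : 0 < u ^+ 2 * x by rewrite mulr_gt0 ?exprn_gt0.
lra.
Qed.

End CostCases.

Theorem theorem3p4 (R : realType) (I : Type) (F : filter_on I)
    (tau : R) (beta eta omega EF : I -> R) (k : I -> nat)
    (matvecs : I -> nat) (solve : I -> Cplx R -> R)
    (tau_gt0 : 0 < tau) (tau_lt1 : tau < 1)
    (beta_lim : beta @ F --> +oo)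
    (eta_lim : eta @ F --> 0^'+)
    (omega_lim : omega @ F --> 0)
    (omega_eta : lesssim F (fun i => `|omega i|) eta)
    (EF_in : forall i, -1 < EF i < 1)
    (k_ge1 : forall i, (1 <= k i)%N)
    (matvecs_le : forall i, (matvecs i <=
       total_matvec_bound tau (beta i) (eta i) (omega i) (EF i) (k i))%N)
    (solve_ge0 : forall i z, 0 <= solve i z)
    (solve_le : exists2 c : R, 0 < c & \forall i \near F,
       forall z, z \in poles (beta i) (EF i) (k i) ->
         solve i z <= c * eta i `^ (- (3 / 2))) :
  let IP (i : I) : R :=
    (total_inner_products tau (beta i) (eta i) (omega i) (EF i) (k i))%:R in
  let other_costs (i : I) : R :=
    (matvecs i)%:R + total_solve_cost (solve i) (beta i) (EF i) (k i) in
  let bound (k : I -> nat) (i : I) : R := cost_bound (beta i) (eta i) (k i) in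
  let minimal : Prop :=
    forall k' : I -> nat, (forall i, (1 <= k' i)%N) ->
      bound k =O_F bound k' in
  [/\ \forall i \near F,
        finite_set (K_rem tau (beta i) (eta i) (omega i) (EF i) (k i))
        /\ finite_set (K_pole tau (eta i) (omega i)),
      other_costs =O_F IP,
      exists f g : I -> R,
        [/\ forall i, IP i = f i + g i,
            f =O_F (fun i => (k i)%:R * eta i `^ (- (3 / 2))),
            lesssim F (fun i => beta i * eta i `^ (1 / 2))
                      (fun i => (k i)%:R) ->
              g =O_F (fun i => eta i `^ (- (3 / 2))),
            lesssim F (fun i => beta i * eta i) (fun i => (k i)%:R) ->
            lesssim F (fun i => (k i)%:R)
                      (fun i => beta i * eta i `^ (1 / 2)) ->
              g =O_F (fun i => beta i * (eta i)^-1 / (k i)%:R)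
          & lesssim F (fun i => (k i)%:R) (fun i => beta i * eta i) ->
              g =O_F (fun i => beta i ^+ 2 / (k i)%:R ^+ 2)]
    & [/\ lesssim F beta (fun i => eta i `^ (- (1 / 2))) ->
          (fun i => (k i)%:R : R) =Theta_F (fun=> 1 : R) ->
            minimal /\ IP =O_F (fun i => eta i `^ (- (3 / 2))),
          lesssim F (fun i => eta i `^ (- (1 / 2))) beta ->
          lesssim F beta (fun i => eta i `^ (- (3 / 2))) ->
          (fun i => (k i)%:R : R) =Theta_F
            (fun i => beta i `^ (1 / 2) * eta i `^ (1 / 4)) ->
            minimal /\
            IP =O_F (fun i => beta i `^ (1 / 2) * eta i `^ (- (5 / 4)))
        & lesssim F (fun i => eta i `^ (- (3 / 2))) beta ->
          (fun i => (k i)%:R : R) =Theta_F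
            (fun i => beta i `^ (2 / 3) * eta i `^ (1 / 2)) ->
            minimal /\
            IP =O_F (fun i => beta i `^ (2 / 3) * (eta i)^-1)]].
Proof.
have [A [B [A0 B0 hpole]]] := near_pole tau_gt0 tau_lt1 beta_lim eta_lim omega_eta.
have [B' B'0 hrem] := near_rem EF tau_gt0 tau_lt1 beta_lim eta_lim omega_eta k_ge1.
move=> IP other_costs bound minimal.
have opt X hX := @cost_optimum R I F tau beta eta omega EF k tau_gt0 tau_lt1
  beta_lim eta_lim omega_eta k_ge1 X hX.
split.
- by move: hpole hrem; apply: filterS2 => i [fp _ _] [fr _].
- exact: (@other_costs_eqO R I F tau beta eta omega EF k tau_gt0 tau_lt1
    beta_lim eta_lim omega_eta k_ge1 matvecs solve matvecs_le solve_ge0 solve_le).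
- pose f i : R := 2 * (k i)%:R * (card_set (K_pole tau (eta i) (omega i)))%:R.
  pose g i : R := (card_set (K_rem tau (beta i) (eta i) (omega i) (EF i) (k i)))%:R.
  exists f, g; split.
  + by move=> i; exact: total_inner_productsE.
  + exact: (@npole_eqO R I F tau beta eta omega k tau_gt0 tau_lt1
      beta_lim eta_lim omega_eta).
  + exact: nrem_small.
  + exact: nrem_medium.
  + exact: nrem_large.
split.
- move=> hb hk; apply: opt.
  + by apply: nearW => i; exact: powR_ge0.
  + exact: cost_case1.
  + by move=> k' k'1; exact: cost_lower1.
- move=> _ hb hk; apply: opt.
  + by apply: nearW => i; rewrite mulr_ge0 ?powR_ge0.
  + exact: cost_case2.
  + by move=> k' k'1; exact: cost_lower2.
- move=> hb hk; apply: opt.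
  + move: (near_params beta_lim eta_lim); apply: filterS => i [_ /andP[e0 _]].
    by rewrite mulr_ge0 ?powR_ge0// invr_ge0 ltW.
  + exact: cost_case3.
  + by move=> k' k'1; exact: cost_lower3.
Qed.
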